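(* Let $(\mathbf a,\mathbf b,\mathbf c)\in\Lambda_{p,q,r}$ be a triple of compositions of finite type, and let $V$ be a vector space of dimension $|\mathbf a|=|\mathbf b|=|\mathbf c|$. Then the $GL(V)$-orbits in $\mathrm{Fl}_{\mathbf a}(V)\times\mathrm{Fl}_{\mathbf b}(V)\times\mathrm{Fl}_{\mathbf c}(V)$ are in natural bijection with families of nonnegative integers $M=(m_{\mathbf d})$ indexed by $\mathbf d\in\Pi_{p,q,r}$ such that, in the semigroup $\Lambda_{p,q,r}$, $$\sum_{\mathbf d\in\Pi_{p,q,r}}m_{\mathbf d}\,\mathbf d=(\mathbf a,\mathbf b,\mathbf c).$$
   Context: All vector spaces are finite-dimensional over a fixed algebraically closed field. A composition is a list $\mathbf a=(a_1,\ldots,a_p)$ of nonnegative integers (zero parts allowed); $|\mathbf a|=a_1+\cdots+a_p$, $\|\mathbf a\|^2=a_1^2+\cdots+a_p^2$, and $\ell(\mathbf a)=p$. For $\dim V=|\mathbf a|$, $\mathrm{Fl}_{\mathbf a}(V)$ is the variety of flags $A=(0=A_0\subset A_1\subset\cdots\subset A_p=V)$ with $\dim(A_i/A_{i-1})=a_i$. For positive integers $p,q,r$, $\Lambda_{p,q,r}$ is the additive semigroup (componentwise addition) of triples of compositions $(\mathbf a,\mathbf b,\mathbf c)$ with $(\ell(\mathbf a),\ell(\mathbf b),\ell(\mathbf c))=(p,q,r)$ and $|\mathbf a|=|\mathbf b|=|\mathbf c|$. A triple is of finite type if $GL(V)$, acting diagonally, has finitely many orbits in $\mathrm{Fl}_{\mathbf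 a}(V)\times\mathrm{Fl}_{\mathbf b}(V)\times\mathrm{Fl}_{\mathbf c}(V)$, $\dim V=|\mathbf a|$. The Tits form is $Q(\mathbf a,\mathbf b,\mathbf c)=\dim GL(V)-\dim\mathrm{Fl}_{\mathbf a}(V)-\dim\mathrm{Fl}_{\mathbf b}(V)-\dim\mathrm{Fl}_{\mathbf c}(V)=\tfrac12(\|\mathbf a\|^2+\|\mathbf b\|^2+\|\mathbf c\|^2-n^2)$ with $n=|\mathbf a|$. $\Pi_{p,q,r}$ is the set of all $\mathbf d\in\Lambda_{p,q,r}$ of finite type with $Q(\mathbf d)=1$. Meaning of ''natural'': let $\mathcal F_{p,q,r}$ be the additive category whose objects are $(V;A,B,C)$ with $V$ a finite-dimensional vector space and $(A,B,C)\in\mathrm{Fl}_{\mathbf a}(V)\times\mathrm{Fl}_{\mathbf b}(V)\times\mathrm{Fl}_{\mathbf c}(V)$ for some $(\mathbf a,\mathbf b,\mathbf c)\in\Lambda_{p,q,r}$ (the dimension vector); morphisms $(V;A,B,C)\to(V';A',B',C')$ are linear maps $f:V\to V'$ with $f(A_i)\subset A_i'$, $f(B_i)\subset B_i'$, $f(C_i)\subset C_i'$ for all $i$; direct sums are componentwise. Isomorphism classes of objects with dimension vector $(\mathbf a,\mathbf b,\mathbf c)$ are identified with $GL(V)$-orbits in $\mathrm{Fl}_{\mathbf a}(V)\times\mathrm{Fl}_{\mathbf b}(V)\times\mathrm{Fl}_{\mathbf c}(V)$. For $\mathbf d\in\Pi_{p,q,r}$, $I_{\mathbf d}$ denotes the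 (unique) isomorphism class of indecomposable objects with dimension vector $\mathbf d$. The bijection sends $M=(m_{\mathbf d})$ to the orbit $\Omega_M$ corresponding to the isomorphism class $\bigoplus_{\mathbf d\in\Pi_{p,q,r}}m_{\mathbf d}I_{\mathbf d}$. *)

(* Defs.v *)
From mathcomp Require Import all_boot all_order all_algebra.
From mathcomp Require Import finmap.
From mathcomp Require Import boolp classical_sets functions cardinality.

Set Implicit Arguments.
Unset Strict Implicit.
Unset Printing Implicit Defensive.

Import GRing.Theory.

Local Open Scope ring_scope.
Local Open Scope classical_set_scope.

Definition composition (p : nat) := {ffun 'I_p -> nat}.

Definition csize (p : nat) (a : composition p) : nat := (\sum_i a i)%N.

Definition csqnorm (p : nat) (a : composition p) : nat := (\sum_i a i ^ 2)%N.

(* The addition is the componentwise one of the library (ffun and products). *)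
Definition triple (p q r : nat) : Type :=
  (composition p * composition q * composition r)%type.

(* The semigroup Lambda_{p,q,r}, as a subset of the additive monoid of all
   triples of compositions. *)
Definition Lambda (p q r : nat) : set (triple p q r) :=
  [set d | csize d.1.1 = csize d.1.2 /\ csize d.1.2 = csize d.2].

Arguments Lambda {p q r}.

Definition Tits (p q r : nat) (d : triple p q r) : rat :=
  ((csqnorm d.1.1)%:R + (csqnorm d.1.2)%:R + (csqnorm d.2)%:R
    - (csize d.1.1)%:R ^+ 2) / 2%:R.

Section Flags.
Variable F : fieldType.

(* The step A_{i-1} < A_i of a flag, 1 <= i <= p, is indexed by i - 1 : 'I_p. *)
Definition lo (p : nat) (i : 'I_p) : 'I_p.+1 := widen_ord (leqnSn p) i.
Definition hi (p : nat) (i : 'I_p) : 'I_p.+1 := lift ord0 i.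

Definition is_flag (V : vectType F) (p : nat)
    (A : {ffun 'I_p.+1 -> {vspace V}}) : bool :=
  [&& A ord0 == 0%VS, A ord_max == fullv
    & [forall i : 'I_p, (A (lo i) <= A (hi i))%VS]].

Record flag (V : vectType F) (p : nat) := Flag {
  flag_val :> {ffun 'I_p.+1 -> {vspace V}};
  flag_valP : is_flag flag_val }.

(* \dim (A_i / A_{i-1}); the truncated subtraction is exact as the A_i increase. *)
Definition flag_type (V : vectType F) (p : nat) (A : flag V p) : composition p :=
  [ffun i => (\dim (A (hi i)) - \dim (A (lo i)))%N].

Definition Fl (V : vectType F) (p : nat) (a : composition p) : Type :=
  {A : flag V p | flag_type A = a}.

Definition Fl3 (V : vectType F) (p q r : nat) (d : triple p q r) : Type :=
  (Fl V d.1.1 * Fl V d.1.2 * Fl V d.2)%type.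

Definition translate (V : vectType F) (p : nat) (g : 'End(V))
    (A : {ffun 'I_p.+1 -> {vspace V}}) : {ffun 'I_p.+1 -> {vspace V}} :=
  [ffun i => (g @: A i)%VS].

Definition orbit3 (V : vectType F) (p q r : nat) (d : triple p q r)
    (X : Fl3 V d) : set (Fl3 V d) :=
  [set Y | exists g : 'End(V), bijective g /\
    [/\ translate g (sval X.1.1) = flag_val (sval Y.1.1),
        translate g (sval X.1.2) = flag_val (sval Y.1.2)
      & translate g (sval X.2) = flag_val (sval Y.2)]].

Definition orbits (V : vectType F) (p q r : nat) (d : triple p q r) :
  set (set (Fl3 V d)) := range (@orbit3 V p q r d).
Arguments orbits V {p q r} d.

Definition finite_type (p q r : nat) (d : triple p q r) : Prop :=
  forall V : vectType F, \dim {:V} = csize d.1.1 -> finite_set (orbits V d).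

Definition Pi (p q r : nat) : set (triple p q r) :=
  [set d | [/\ Lambda d, finite_type d & Tits d = 1]].

End Flags.

Arguments orbits {F} V {p q r} d.
Arguments finite_type F {p q r} d.
Arguments Pi F {p q r}.

Section Category.
Variables (F : fieldType) (p q r : nat).

Record obj := Obj {
  ospace : vectType F;
  flagA : flag ospace p;
  flagB : flag ospace q;
  flagC : flag ospace r }.

Definition dimvec (X : obj) : triple p q r :=
  (flag_type (flagA X), flag_type (flagB X), flag_type (flagC X)).

Definition obj_of (V : vectType F) (d : triple p q r) (X : Fl3 V d) : obj :=
  Obj (sval X.1.1) (sval X.1.2) (sval X.2).

Definition is_morph (X Y : obj) (f : 'Hom(ospace X, ospace Y)) : Prop :=
  [/\ forall i, (f @: flagA X i <= flagA Y i)%VS,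
      forall i, (f @: flagB X i <= flagB Y i)%VS
    & forall i, (f @: flagC X i <= flagC Y i)%VS].

Definition iso (X Y : obj) : Prop :=
  exists (f : 'Hom(ospace X, ospace Y)) (g : 'Hom(ospace Y, ospace X)),
    [/\ is_morph f, is_morph g, (g \o f)%VF = \1%VF & (f \o g)%VF = \1%VF].

Lemma zero_flag_subproof (k : nat) :
  is_flag [ffun _ : 'I_k.+1 => 0%VS : {vspace 'rV[F]_0}].
Proof.
rewrite /is_flag !ffunE eqxx /=; apply/andP; split.
  by apply/eqP/vspaceP=> v; rewrite memvf [v]thinmx0 mem0v.
by apply/forallP=> i; rewrite !ffunE subvv.
Qed.

Definition zero_obj : obj :=
  Obj (Flag (zero_flag_subproof p)) (Flag (zero_flag_subproof q))
      (Flag (zero_flag_subproof r)).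

(* The subspace U (+) W of V1 (+) V2 = V1 * V2. *)
Definition vsum (V1 V2 : vectType F) (U : {vspace V1}) (W : {vspace V2}) :
    {vspace (V1 * V2)%type} :=
  (linfun (@fst V1 V2) @^-1: U :&: linfun (@snd V1 V2) @^-1: W)%VS.

Lemma mem_vsum (V1 V2 : vectType F) (U : {vspace V1}) (W : {vspace V2}) x :
  (x \in vsum U W) = (x.1 \in U) && (x.2 \in W).
Proof. by rewrite memv_cap -!memv_preim !lfunE. Qed.

Lemma sum_flag_subproof (V1 V2 : vectType F) (k : nat) (A1 : flag V1 k)
    (A2 : flag V2 k) : is_flag [ffun i => vsum (A1 i) (A2 i)].
Proof.
have /and3P[/eqP A10 /eqP A1m /forallP A1S] := flag_valP A1.
have /and3P[/eqP A20 /eqP A2m /forallP A2S] := flag_valP A2.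
apply/and3P; split; rewrite ?ffunE.
- apply/eqP/vspaceP=> -[x y].
  by rewrite mem_vsum A10 A20 !memv0.
- by apply/eqP/vspaceP=> x; rewrite mem_vsum A1m A2m !memvf.
- apply/forallP=> i; rewrite !ffunE; apply/subvP=> x; rewrite !mem_vsum.
  by case/andP=> /(subvP (A1S i)) -> /(subvP (A2S i)) ->.
Qed.

Definition dsum (X Y : obj) : obj :=
  Obj (Flag (sum_flag_subproof (flagA X) (flagA Y)))
      (Flag (sum_flag_subproof (flagB X) (flagB Y)))
      (Flag (sum_flag_subproof (flagC X) (flagC Y))).

Definition indecomposable (X : obj) : Prop :=
  ~ iso X zero_obj /\
  forall Y Z : obj, iso X (dsum Y Z) -> iso Y zero_obj \/ iso Z zero_obj.

(* A family (m_d) indexed by Pi_{p,q,r} is a finitely supported function on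
   all triples whose support lies in Pi_{p,q,r}.  The sum only makes sense for
   finite support; since no d in Pi_{p,q,r} is zero, this excludes nothing. *)
Definition families (d : triple p q r) : set {fsfun triple p q r -> nat with 0%N} :=
  [set M | (forall e, e \in finsupp M -> Pi F e) /\
           \sum_(e <- finsupp M) e *+ M e = d].

Definition mult_dsum (I : triple p q r -> obj)
    (M : {fsfun triple p q r -> nat with 0%N}) : obj :=
  \big[dsum/zero_obj]_(e <- finsupp M) iter (M e) (dsum (I e)) zero_obj.

Definition Omega (I : triple p q r -> obj) (V : vectType F) (d : triple p q r)
    (M : {fsfun triple p q r -> nat with 0%N}) : set (Fl3 V d) :=
  [set X | iso (obj_of X) (mult_dsum I M)].

End Category.

Arguments families F {p q r} d.
Arguments Omega {F p q r} I V d M.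

(* Main.v *)
(** The classical proofs use Kac's theorem and the geometry of orbits.  Here both
    are replaced by one-parameter families and elementary linear algebra.

    Call X rigid when Ext^1(X,X) = 0, i.e. when every triple of endomorphisms of
    the underlying space is congruent to a single one modulo the three parabolic
    subalgebras of X.  Then dim End X >= Q(dim X), with equality iff X is rigid.

    If d is of finite type, the dimensions of Hom(-,T), T ranging over the
    finitely many objects of dimension d, can all be minimised at once, because
    two objects are joined by a line on whose generic points these dimensions do
    not exceed the two end values.  The minimiser Z satisfies dim Hom(Z,Z) <= dim
    Hom(X,Z) for all X of dimension d, and first order expansion along lines
    through Z shows that Z is rigid.  Hence Q(d) >= 1 for d <> 0.  Conversely a
    rigid object is isomorphic to the generic points of any line through it, so
    two rigid objects of the same dimension are isomorphic.

    An indecomposable X of finite type is a brick: otherwise take a nonzero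
    non-injective endomorphism g of least rank.  By Fitting's lemma g^2 = 0, so g
    maps X to ker g, and some indecomposable summand L of ker g receives a nonzero
    map phi from X; minimality gives ker phi = ker g.  By induction L is rigid, and
    this lets the projection ker g -> L be extended to X, so that L is a proper
    summand of X.  A brick satisfies 1 = dim End X >= Q >= 1, so it is rigid with
    Q = 1.  The rest is Krull-Schmidt; cancellation also shows that summands of
    dimensions of finite type are of finite type. *)
Require Import Defs.
From HB Require Import structures.
From mathcomp Require Import all_boot all_order all_algebra.
From mathcomp Require Import zify ring.
From mathcomp Require Import finmap.
From mathcomp Require Import boolp classical_sets functions cardinality.

Set Implicit Arguments.
Unset Strict Implicit.
Unset Printing Implicit Defensive.

Import GRing.Theory Num.Theory VectorInternalTheory.
Local Open Scope ring_scope.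

(** * One-parameter families over an infinite field *)

Section AlmostAll.
Variable F : fieldType.

(** Genericity on the affine line: a finite list holds all exceptions. Over an infinite field,
    finitely many generic conditions have a common solution. *)
Definition almost_all (Q : F -> Prop) :=
  exists s : seq F, forall t, t \notin s -> Q t.

Lemma almost_allT (Q : F -> Prop) : (forall t, Q t) -> almost_all Q.
Proof. by move=> QT; exists [::]. Qed.

Lemma almost_allI (Q1 Q2 : F -> Prop) :
  almost_all Q1 -> almost_all Q2 -> almost_all (fun t => Q1 t /\ Q2 t).
Proof.
case=> s1 h1 [s2 h2]; exists (s1 ++ s2) => t.
by rewrite mem_cat negb_or => /andP[/h1 ? /h2].
Qed.

Lemma almost_allS (Q1 Q2 : F -> Prop) :
  (forall t, Q1 t -> Q2 t) -> almost_all Q1 -> almost_all Q2.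
Proof. by move=> h [s hs]; exists s => t /hs /h. Qed.

Lemma almost_all_bounded (Q : nat -> F -> Prop) n :
  (forall k, (k < n)%N -> almost_all (Q k)) ->
  almost_all (fun t => forall k, (k < n)%N -> Q k t).
Proof.
elim: n => [|n IH] h; first exact: almost_allT.
have h1 : almost_all (fun t => forall k, (k < n)%N -> Q k t).
  by apply: IH => k kn; apply: h; rewrite ltnS ltnW.
apply: almost_allS (almost_allI h1 (h n (leqnn _))) => t [hlt hn] k.
by rewrite ltnS leq_eqVlt => /predU1P[-> //|/hlt].
Qed.

Lemma almost_all_neq (a : F) : almost_all (fun t => t != a).
Proof. by exists [:: a] => t; rewrite inE. Qed.

Definition infinite_field := forall s : seq F, exists t, t \notin s.

Lemma almost_all_ex (Q : F -> Prop) : infinite_field -> almost_all Q -> exists t, Q t.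
Proof. by move=> infF [s hs]; have [t /hs] := infF s; exists t. Qed.

(** Roots are split off one linear factor at a time, by induction on the size of [P]. *)
Lemma almost_all_poly (P : {poly F}) (t0 : F) :
  P.[t0] != 0 -> almost_all (fun t => P.[t] != 0).
Proof.
move=> Pt0; have {Pt0} : P != 0.
  by apply: contraNneq Pt0 => ->; rewrite horner0.
have [n] := ubnP (size P); elim: n => // n IH in P *; rewrite ltnS => sP P0.
have [[a /factor_theorem[R PR]]|no] := pselect (exists a, root P a); last first.
  by exists [::] => t _; apply/negP => Pt; case: no; exists t.
have R0 : R != 0 by apply: contraNneq P0 => R0; rewrite PR R0 mul0r.
have [|s hs] := IH R _ R0.
  by move: sP; rewrite PR size_Mmonic ?monicXsubC // size_XsubC addn2.
exists (a :: s) => t; rewrite inE negb_or => /andP[ta /hs Rt].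
by rewrite PR hornerM mulf_neq0 // hornerXsubC subr_eq0.
Qed.

End AlmostAll.

(** * Matrix pencils: semicontinuity of the rank, tangents, kernel vectors *)

Section Pencils.
Variable F : fieldType.

Lemma det_pencil n (A B : 'M[F]_n) : exists P : {poly F},
  forall t, P.[t] = \det (A + t *: B).
Proof.
exists (\det (map_mx polyC A + 'X *: map_mx polyC B)) => t.
rewrite -[LHS]/(horner_eval t _) -det_map_mx map_mxD map_mxZ -!map_mx_comp.
congr (\det (_ + _)).
  by apply/matrixP=> i j; rewrite !mxE /= horner_evalE hornerC.
congr (_ *: _); first by rewrite /= horner_evalE hornerX.
by apply/matrixP=> i j; rewrite !mxE /= horner_evalE hornerC.
Qed.

(** A coordinate-free invertible minor of maximal size, from one-sided inverses of the two factors
    of a full-rank factorisation. *)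
Lemma rank_sandwich m n (A : 'M[F]_(m, n)) :
  exists (L : 'M_(\rank A, m)) (R : 'M_(n, \rank A)), L *m A *m R = 1%:M.
Proof.
exists (pinvmx (col_base A)), (pinvmx (row_base A)).
rewrite -[X in _ *m X *m _]mulmx_base (mulmxA _ (col_base A)).
by rewrite mulVpmx ?col_base_full // mul1mx mulmxVp ?row_base_free.
Qed.

(** Lower semicontinuity of the rank: the maximal minor selected by [L] and [R] at [t0] is a
    polynomial in [t] that does not vanish at [t0]. *)
Lemma rank_pencil m n (A B : 'M[F]_(m, n)) (t0 : F) :
  almost_all (fun t => (\rank (A + t0 *: B)%R <= \rank (A + t *: B)%R)%N).
Proof.
set C := A + t0 *: B.
have [L [R LCR]] := rank_sandwich C.
have [P HP] := det_pencil (L *m A *m R) (L *m B *m R).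
have HP' t : P.[t] = \det (L *m (A + t *: B) *m R).
  by rewrite HP mulmxDr mulmxDl -scalemxAr -scalemxAl.
have Pt0 : P.[t0] != 0.
  by rewrite HP' -/C LCR det1 oner_eq0.
apply: almost_allS (almost_all_poly Pt0) => t; rewrite HP' -unitfE => u.
have /mxrank_unit rk : L *m (A + t *: B) *m R \in unitmx by rewrite unitmxE.
have : (\rank (L *m (A + t *: B) *m R) <= \rank (A + t *: B)%R)%N.
  exact: leq_trans (mxrankM_maxl _ _) (mxrankM_maxr _ _).
by rewrite rk.
Qed.

(** As [x *m (A + t *: B) = t *: (x *m B)], the row [x *m B] lies in the row space of [A + t *: B]
    for [t != 0]. Were it outside that of [A], then together with a perturbed row basis of [A] it
    would force generic rank above [\rank A]. *)
Lemma pencil_tangent m n (A B : 'M[F]_(m, n)) (x : 'rV_m) :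
  infinite_field F -> almost_all (fun t => (\rank (A + t *: B)%R <= \rank A)%N) ->
  x *m A = 0 -> (x *m B <= A)%MS.
Proof.
move=> infF rkA xA; apply/idPn => xB.
pose L := pinvmx (col_base A).
have LA : L *m A = row_base A.
  by rewrite -[X in L *m X]mulmx_base mulmxA mulVpmx ?col_base_full // mul1mx.
(* A row basis of [A], perturbed along the pencil, above the row [x *m B], which is kept
   constant. *)
pose A' := col_mx (L *m A) (x *m B); pose B' : 'M_(\rank A + 1, n) := col_mx (L *m B) 0.
have rk0 : \rank (A' + 0 *: B')%R = (\rank A).+1.
  rewrite scale0r addr0 /A' LA -addsmxE.
  have -> : \rank (row_base A + x *m B)%MS = \rank (A + x *m B)%MS.
    by rewrite (adds_eqmx (eq_row_base _) (eqmx_refl _)).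
  apply/eqP; rewrite eqn_leq; apply/andP; split.
    apply: leq_trans (mxrank_adds_leqif _ _) _.
    by rewrite -[X in (_ <= X)%N]addn1 leq_add2l rank_leq_row.
  rewrite ltn_neqAle mxrankS ?addsmxSl // andbT.
  apply: contra xB => /eqP e.
  have := mxrank_leqif_sup (addsmxSl A (x *m B)) => -[_].
  rewrite e eqxx => /esym; exact: submx_trans (addsmxSr _ _).
have := rank_pencil A' B' 0; rewrite rk0 => h.
have [t [[h1 h2] tn0]] := almost_all_ex infF (almost_allI (almost_allI h rkA) (almost_all_neq 0)).
have : (\rank (A' + t *: B')%R <= \rank (A + t *: B)%R)%N.
  apply: mxrankS; rewrite /A' /B' scale_col_mx add_col_mx scaler0 addr0 -addsmxE.
  rewrite addsmx_sub scalemxAr -mulmxDr submxMl /=.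
  have -> : x *m B = t^-1 *: (x *m (A + t *: B)).
    by rewrite mulmxDr xA add0r -scalemxAr scalerA mulVf // scale1r.
  by rewrite scalemx_sub // submxMl.
move=> h3; have := leq_trans h1 (leq_trans h3 h2).
by rewrite ltnn.
Qed.

(** The rank is maximal at 0, so the kernel vector [x] extends to one depending polynomially on [t];
    the determinant of its image under [E] is then a polynomial that is nonzero at 0. *)
Lemma pencil_kernel_det m n k (A B : 'M[F]_(m, n)) (x : 'rV_m)
    (E : {linear 'rV[F]_m -> 'M[F]_k}) :
  (forall t, (\rank (A + t *: B)%R <= \rank A)%N) ->
  x *m A = 0 -> \det (E x) != 0 ->
  almost_all (fun t => exists2 y : 'rV_m, y *m (A + t *: B) = 0 & \det (E y) != 0).
Proof.
move=> rkA xA Ex.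
have [L [R LAR]] := rank_sandwich A.
pose Ct t := A + t *: B.
pose D t := L *m Ct t *m R.
have D0 : D 0 = 1%:M.
  by rewrite /D /Ct scale0r addr0.
(* The solution of y (A + t B) = 0 given by Cramer's rule, with y 0 = x. *)
pose y t := \det (D t) *: x - x *m Ct t *m R *m \adj (D t) *m L.
have yker t : \det (D t) != 0 -> y t *m Ct t = 0.
  move=> dt.
  have yR : y t *m Ct t *m R = 0.
    rewrite /y mulmxBl mulmxBl -!mulmxA -scalemxAl.
    rewrite [L *m (Ct t *m R)]mulmxA -/(D t) mul_adj_mx.
    by rewrite mul_mx_scalar -!scalemxAr subrr.
  have : (\rank (Ct t) <= \rank (Ct t *m R))%N.
    apply: leq_trans (rkA t) _.
    have du : D t \in unitmx by rewrite unitmxE unitfE.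
    by rewrite -[X in (X <= _)%N](mxrank_unit du) /D -mulmxA mxrankM_maxr.
  move=> rk.
  have e := mxrank_mul_ker (Ct t) R.
  have /eqP : \rank (Ct t :&: kermx R)%MS = 0%N.
    apply/eqP; rewrite -leqn0 -(leq_add2l (\rank (Ct t *m R))) e addn0 //.
  rewrite mxrank_eq0 => /eqP cap0; apply/eqP.
  rewrite -submx0 -cap0 sub_capmx submxMl /=; exact/sub_kermxP.
(* The same formulas over the polynomial ring; evaluating them shows that both determinants are
   polynomial in [t]. *)
pose CP : 'M[{poly F}]_(m, n) := map_mx polyC A + 'X *: map_mx polyC B.
pose lft a b (M : 'M[F]_(a, b)) : 'M[{poly F}]_(a, b) := map_mx polyC M.
pose DP := lft _ _ L *m CP *m lft _ _ R.
pose yP := \det DP *: lft _ _ x - lft _ _ x *m CP *m lft _ _ R *m \adj DP *m lft _ _ L.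
have lftE a b (M : 'M[F]_(a, b)) t : map_mx (horner_eval t) (lft _ _ M) = M.
  by apply/matrixP=> i j; rewrite !mxE horner_evalE hornerC.
have CPE t : map_mx (horner_eval t) CP = Ct t.
  rewrite /CP map_mxD map_mxZ -/(lft _ _ A) -/(lft _ _ B) !lftE.
  by rewrite /= horner_evalE hornerX.
have DPE t : map_mx (horner_eval t) DP = D t.
  by rewrite /DP !map_mxM !lftE CPE.
have yPE t : map_mx (horner_eval t) yP = y t.
  rewrite /yP map_mxB map_mxZ !map_mxM map_mx_adj DPE !lftE CPE /y.
  by rewrite -det_map_mx DPE.
pose EP := \sum_i yP 0 i *: lft _ _ (E (delta_mx 0 i)).
have EPE t : map_mx (horner_eval t) EP = E (y t).
  rewrite [y t]row_sum_delta linear_sum /EP.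
  rewrite -[LHS]/(map_mx (horner_eval t) _) raddf_sum; apply: eq_bigr => i _.
  by rewrite linearZ /= map_mxZ lftE -yPE [(map_mx _ _) 0 i]mxE.
have detE t : (\det EP).[t] = \det (E (y t)).
  by rewrite -[LHS]/(horner_eval t _) -det_map_mx EPE.
have detD t : (\det DP).[t] = \det (D t).
  by rewrite -[LHS]/(horner_eval t _) -det_map_mx DPE.
have y0 : y 0 = x.
  by rewrite /y D0 det1 scale1r /Ct scale0r addr0 xA !mul0mx subr0.
have h1 : (\det EP).[0] != 0 by rewrite detE y0.
have h2 : (\det DP).[0] != 0 by rewrite detD D0 det1 oner_eq0.
apply: almost_allS (almost_allI (almost_all_poly h1) (almost_all_poly h2)).
move=> t; rewrite detE detD => -[h3 h4]; exists (y t) => //; exact: yker.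
Qed.

End Pencils.

(** * Subspaces and linear maps, with and without coordinates *)

Section LinearMaps.
Variable F : fieldType.
Implicit Types U V W L T : vectType F.

Lemma lfun_of_linear U T (f : U -> T) :
  linear f -> exists M : 'Hom(U, T), M =1 f.
Proof.
move=> lf; pose lM := GRing.isLinear.Build F U T *:%R f lf.
pose fL : {linear U -> T} := HB.pack f lM.
by exists (linfun fL) => x; rewrite lfunE.
Qed.

(** A subspace of largest dimension inside [P] is all of [P], since adjoining a further vector of
    [P] would enlarge it. *)
Lemma vspace_of_closed V (P : V -> Prop) :
  P 0 -> (forall a u v, P u -> P v -> P (a *: u + v)) ->
  exists U : {vspace V}, forall v, v \in U <-> P v.
Proof.
move=> P0 Plin.
pose sub (U : {vspace V}) := forall v, v \in U -> P v.
pose q k := `[< exists2 U, sub U & \dim U = k >].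
have q0 : exists k, q k.
  exists 0%N; apply/asboolP; exists 0%VS; rewrite ?dimv0 // => v.
  by rewrite memv0 => /eqP->.
have qb k : q k -> (k <= \dim {:V})%N.
  by move=> /asboolP[U _ <-]; apply: dimvS; apply: subvf.
case: (ex_maxnP q0 qb) => k /asboolP[U sU dU] kmax; exists U => v.
split=> [/sU //|Pv]; apply/idPn => vU.
have : q (\dim (U + <[v]>)).
  apply/asboolP; exists (U + <[v]>)%VS => // w /memv_addP[u uU [w' /vlineP[a ->] ->]].
  by rewrite addrC; apply: Plin => //; apply: sU.
move/kmax; rewrite -dU => h.
have := dimv_leqif_sup (addvSl U <[v]>) => -[_].
rewrite eqn_leq h dimvS ?addvSl //= subv_add subvv /= => /esym.
by rewrite -memvE (negPf vU).
Qed.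

(** [phi^-1] chooses preimages over the image of [phi]; two preimages differ by an element of
    [lker phi], which [psi] kills. *)
Lemma lfun_factor V L W (phi : 'Hom(V, L)) (psi : 'Hom(V, W)) :
  (lker phi <= lker psi)%VS -> exists alpha : 'Hom(L, W), psi = (alpha \o phi)%VF.
Proof.
move=> /subvP kphi; exists (psi \o phi^-1)%VF; apply/lfunP => x.
rewrite !comp_lfunE; apply/eqP; rewrite -subr_eq0 -linearB -memv_ker kphi //.
by rewrite memv_ker linearB /= limg_lfunVK ?memv_img ?memvf // subrr.
Qed.

Lemma lfun_onto V W (D : {vspace V}) (D' : {vspace W}) :
  \dim D = \dim D' -> exists theta : 'Hom(V, W), (theta @: D = D')%VS.
Proof.
move=> dD; have [f fP] := linear_of_free (vbasis D) (vbasis D').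
have fr : free (vbasis D) := basis_free (vbasisP _).
exists (linfun f).
rewrite -{1}(span_basis (vbasisP D)) limg_span.
have -> : map (linfun f) (vbasis D) = vbasis D'.
  rewrite -fP // ?size_tuple ?dD //; by apply: eq_map => x; rewrite lfunE.
exact: span_basis (vbasisP _).
Qed.

Lemma dim_vsum V1 V2 (U : {vspace V1}) (W : {vspace V2}) :
  \dim (vsum U W) = (\dim U + \dim W)%N.
Proof.
rewrite -(limg_ker_dim (linfun (@fst V1 V2)) (vsum U W)) addnC; congr (_ + _)%N.
  congr (\dim _); apply/vspaceP => x; apply/memv_imgP/idP.
    by case=> y; rewrite mem_vsum lfunE => /andP[? _] ->.
  by move=> xU; exists (x, 0); rewrite ?mem_vsum ?lfunE //= xU mem0v.
have [g gE] : exists g : 'Hom(V2, (V1 * V2)%type), g =1 (fun w => (0, w)).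
  by apply: lfun_of_linear => a u v; congr (_, _); rewrite /= scaler0 addr0.
rewrite -[RHS](@limg_dim_eq _ _ _ g); last first.
  apply/eqP; rewrite -subv0; apply/subvP => x; rewrite memv_cap memv_ker memv0 gE.
  by case/andP=> _ /eqP[->].
congr (\dim _); apply/vspaceP => x; apply/idP/memv_imgP.
  rewrite memv_cap mem_vsum memv_ker lfunE => /andP[/andP[_ xW] /eqP x1].
  by exists x.2; rewrite // gE -x1 -surjective_pairing.
case=> w wW ->; rewrite gE memv_cap mem_vsum memv_ker lfunE /= mem0v wW eqxx //.
Qed.

Lemma v2r_lfun U T (f : 'Hom(U, T)) x : v2r (f x) = v2r x *m f2mx f.
Proof. by rewrite unlock /= r2vK. Qed.

Lemma mul_f2mx U T (f : 'Hom(U, T)) (u : 'rV_(dim U)) : u *m f2mx f = v2r (f (r2v u)).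
Proof. by rewrite v2r_lfun r2vK. Qed.

Lemma f2mx_pencil U T (f g : 'Hom(U, T)) t : f2mx (f + t *: g) = f2mx f + t *: f2mx g.
Proof.
apply/row_matrixP => i; rewrite !rowE mulmxDr -scalemxAr !mul_f2mx.
by rewrite add_lfunE scale_lfunE linearD linearZ.
Qed.

Lemma rank_f2mx U T (f : 'Hom(U, T)) : \rank (f2mx f) = \dim (limg f).
Proof.
have := limg_ker_dim f fullv; rewrite capfv dimvf => e.
apply/eqP; rewrite -(eqn_add2l (\dim (lker f))) e /dimv /= mxrank_gen mxrank_ker.
by rewrite subnK ?rank_leq_row.
Qed.

Lemma lker0_det V (f : 'End(V)) : (\det (f2mx f) != 0) = (lker f == 0%VS).
Proof.
rewrite -unitfE -unitmxE -row_free_unit -kermx_eq0 -dimv_eq0 /dimv /=.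
by rewrite mxrank_gen mxrank_eq0.
Qed.

End LinearMaps.

(** * Pencils of linear maps *)

Section LinearPencils.
Variable F : fieldType.
Implicit Types U V W L T : vectType F.

Lemma lfun_pencil_ker U T (M0 M1 : 'Hom(U, T)) t0 : almost_all (fun t =>
  (\dim (lker (M0 + t *: M1)%R) <= \dim (lker (M0 + t0 *: M1)%R))%N).
Proof.
apply: almost_allS (rank_pencil (f2mx M0) (f2mx M1) t0) => t.
rewrite -!f2mx_pencil !rank_f2mx => h.
have := limg_ker_dim (M0 + t *: M1) fullv; rewrite capfv => e1.
have := limg_ker_dim (M0 + t0 *: M1) fullv; rewrite capfv => e2.
by rewrite -(leq_add2r (\dim (limg (M0 + t0 *: M1)%R))) e2 -e1 leq_add2l.
Qed.

Lemma lfun_pencil_tangent U T (M0 M1 : 'Hom(U, T)) x :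
  infinite_field F -> almost_all (fun t => (\dim (lker M0) <= \dim (lker (M0 + t *: M1)%R))%N) ->
  M0 x = 0 -> M1 x \in limg M0.
Proof.
move=> infF dk M0x.
have h : (v2r x *m f2mx M1 <= f2mx M0)%MS.
  apply: (pencil_tangent infF); last by rewrite -v2r_lfun M0x linear0.
  apply: almost_allS dk => t dk; rewrite -f2mx_pencil !rank_f2mx.
  have := limg_ker_dim (M0 + t *: M1) fullv; rewrite capfv => e1.
  have := limg_ker_dim M0 fullv; rewrite capfv => e2.
  by rewrite -(leq_add2l (\dim (lker M0))) e2 -e1 leq_add2r.
have /submxP[u hu] := h; apply/memv_imgP; exists (r2v u); first exact: memvf.
by apply: v2r_inj; rewrite !v2r_lfun r2vK; exact: hu.
Qed.

(** An automorphism in the kernel at 0 deforms to automorphisms in the nearby kernels: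
    [pencil_kernel_det] is applied with [E] sending the coordinates of an endomorphism to its
    matrix. *)
Lemma lfun_pencil_unit V T (M0 M1 : 'Hom('End(V), T)) (x : 'End(V)) :
  (forall t, \dim (lker M0) <= \dim (lker (M0 + t *: M1)%R))%N ->
  M0 x = 0 -> lker x == 0%VS ->
  almost_all (fun t => exists2 y, (M0 + t *: M1) y = 0 & lker y == 0%VS).
Proof.
move=> dk M0x x0.
pose E (u : 'rV[F]_(dim 'End(V))) : 'M[F]_(dim V) := f2mx (r2v u : 'End(V)).
have linE : linear E.
  by move=> a u v; rewrite /E linearD linearZ /= [X in f2mx X]addrC f2mx_pencil addrC.
pose lM := GRing.isLinear.Build F _ _ *:%R E linE.
pose EL : {linear _ -> _} := HB.pack E lM.
have := @pencil_kernel_det F _ _ _ (f2mx M0) (f2mx M1) (v2r x) EL.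
rewrite /= /E v2rK lker0_det -v2r_lfun M0x linear0.
case=> //.
  move=> t; rewrite -f2mx_pencil !rank_f2mx.
  have := limg_ker_dim (M0 + t *: M1) fullv; rewrite capfv => e1.
  have := limg_ker_dim M0 fullv; rewrite capfv => e2.
  by rewrite -(leq_add2l (\dim (lker M0))) e2 -e1 leq_add2r.
move=> s hs; exists s => t /hs[y]; rewrite -f2mx_pencil mul_f2mx lker0_det => h1 h2.
by exists (r2v y) => //; apply: v2r_inj; rewrite h1 linear0.
Qed.

End LinearPencils.

(** * Flags *)

Section SingleFlags.
Variable F : fieldType.
Implicit Types U V W L : vectType F.

Section OneFlag.
Variables (V : vectType F) (p : nat) (A : flag V p).

(** Natural-number indices allow induction along the flag; an index beyond [p] defaults to 0. *)
Definition step (k : nat) : {vspace V} := A (inord k).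

Lemma stepE (i : 'I_p.+1) : A i = step i.
Proof. by rewrite /step inord_val. Qed.

Lemma loE (i : 'I_p) : A (lo i) = step i.
Proof. by rewrite stepE. Qed.

Lemma hiE (i : 'I_p) : A (hi i) = step i.+1.
Proof. by rewrite stepE lift0. Qed.

Lemma step0 : step 0 = 0%VS.
Proof.
have /and3P[/eqP A0 _ _] := flag_valP A.
by rewrite -A0 [RHS]stepE.
Qed.

Lemma step_max : step p = fullv.
Proof.
have /and3P[_ /eqP Am _] := flag_valP A.
by rewrite -Am [RHS]stepE.
Qed.

Lemma stepS k : (k < p)%N -> (step k <= step k.+1)%VS.
Proof.
move=> kp; have /and3P[_ _ /forallP /(_ (Ordinal kp))] := flag_valP A.
by rewrite loE hiE.
Qed.

Lemma step_le j k : (j <= k)%N -> (k <= p)%N -> (step j <= step k)%VS.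
Proof.
elim: k => [|k IH]; first by rewrite leqn0 => /eqP->.
rewrite leq_eqVlt => /predU1P[-> //|]; rewrite ltnS => jk kp.
exact: subv_trans (IH jk (ltnW kp)) (stepS kp).
Qed.

Lemma flag_typeE (i : 'I_p) :
  flag_type A i = (\dim (step i.+1) - \dim (step i))%N.
Proof. by rewrite ffunE loE hiE. Qed.

Lemma dim_step k : (k <= p)%N ->
  \dim (step k) = (\sum_(i < p | (i < k)%N) flag_type A i)%N.
Proof.
elim: k => [|k IH] kp; first by rewrite step0 dimv0 big_pred0.
rewrite (bigD1 (Ordinal kp)) //= flag_typeE /=.
rewrite (eq_bigl (fun i : 'I_p => (i < k)%N)).
  by rewrite -IH ?subnK ?(ltnW kp) // dimvS // stepS.
by move=> i; rewrite -val_eqE /= ltnS ltn_neqAle andbC.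
Qed.

Lemma csize_flag_type : csize (flag_type A) = \dim {:V}.
Proof.
rewrite -step_max dim_step // /csize; apply: eq_bigl => i.
by rewrite ltn_ord.
Qed.

End OneFlag.

Lemma flag_of_steps V p (f : nat -> {vspace V}) :
  f 0%N = 0%VS -> f p = fullv -> (forall k, (k < p)%N -> (f k <= f k.+1)%VS) ->
  exists A : flag V p, forall i, A i = f i.
Proof.
move=> f0 fp fS.
suff AP : is_flag [ffun i : 'I_p.+1 => f i].
  by exists (Flag AP) => i; rewrite /= ffunE.
apply/and3P; split; rewrite ?ffunE ?f0 //= ?fp //.
by apply/forallP => i; rewrite !ffunE lift0 /= fS.
Qed.

Lemma flag_inj V p (A B : flag V p) : flag_val A = flag_val B -> A = B.
Proof.
case: A B => A hA [B hB] /= e; rewrite -e in hB *.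
by congr Flag; apply: eq_irrelevance.
Qed.

Lemma eq_dim_step V W p (A : flag V p) (B : flag W p) :
  flag_type A = flag_type B -> forall i, \dim (A i) = \dim (B i).
Proof.
move=> e i; rewrite !stepE !dim_step ?leq_ord //.
by apply: eq_bigr => j _; rewrite e.
Qed.

Lemma eq_flag_type V W p (A : flag V p) (B : flag W p) :
  (forall i, \dim (A i) = \dim (B i)) -> flag_type A = flag_type B.
Proof. by move=> e; apply/ffunP => i; rewrite !ffunE !e. Qed.

(** The standard flag: spans of initial segments of a basis, of lengths the partial sums of [a]. *)
Lemma flag_ex V p (a : composition p) : \dim {:V} = csize a ->
  exists A : flag V p, flag_type A = a.
Proof.
move=> dV; pose s k := (\sum_(i < p | (i < k)%N) a i)%N.
have sS (i : 'I_p) : s i.+1 = (s i + a i)%N.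
  rewrite /s (bigD1 i) //= addnC; congr (_ + _)%N; apply: eq_bigl => j.
  by rewrite -val_eqE /= ltnS ltn_neqAle andbC.
have sp : s p = \dim {:V}.
  by rewrite dV; apply: eq_bigl => i; rewrite ltn_ord.
have smono k : (k <= p)%N -> (s k <= \dim {:V})%N.
  move=> kp; rewrite dV /csize [X in (_ <= X)%N](bigID (fun i : 'I_p => (i < k)%N)) /=.
  exact: leq_addr.
pose f k := <<take (s k) (vbasis (fullv : {vspace V}))>>%VS.
have fr : free (vbasis (fullv : {vspace V})) := basis_free (vbasisP _).
have df k : (k <= p)%N -> \dim (f k) = s k.
  move=> kp; have : free (take (s k) (vbasis (fullv : {vspace V}))).
    by apply: (@catl_free _ _ (drop (s k) (vbasis fullv))); rewrite cat_take_drop.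
  rewrite /free => /eqP; rewrite -/(f k) => ->.
  rewrite size_take size_tuple; case: ltnP => // h.
  by apply/eqP; rewrite eqn_leq h smono.
have [|||A AE] := @flag_of_steps V p f.
- by apply/eqP; rewrite -dimv_eq0 df // /s big_pred0.
- by rewrite /f sp take_oversize ?size_tuple // (span_basis (vbasisP _)).
- move=> k kp; apply: sub_span => x.
  by rewrite -(@take_takel _ _ (s k.+1)) ?(sS (Ordinal kp)) ?leq_addr // => /mem_take.
exists A; apply/ffunP => i; rewrite flag_typeE /step !AE !inordK ?ltnS //; last exact: ltnW.
by rewrite !df // ?sS ?addKn // ltnW.
Qed.

(** Transitivity of GL on flags of one type. The map is built step by step: it keeps its values on
    A_k and sends a complement of A_k in A_(k+1) onto a complement of B_k in B_(k+1), of the same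
    dimension. *)
Lemma flag_conj V W p (A : flag V p) (B : flag W p) :
  flag_type A = flag_type B ->
  exists2 g : 'Hom(V, W), lker g == 0%VS & forall i, (g @: A i)%VS = B i.
Proof.
move=> eAB; have ed k : \dim (step A k) = \dim (step B k) by exact: eq_dim_step.
have [g gAB] : exists g : 'Hom(V, W),
    forall j, (j <= p)%N -> (g @: step A j)%VS = step B j.
  suff: forall k, (k <= p)%N -> exists g : 'Hom(V, W),
      forall j, (j <= k)%N -> (g @: step A j)%VS = step B j by apply.
  elim=> [|k IH] kp.
    by exists 0 => j; rewrite leqn0 => /eqP->; rewrite lim0g step0.
  have [g gAB] := IH (ltnW kp).
  pose U := step A k; pose D := (step A k.+1 :\: step A k)%VS.
  pose D' := (step B k.+1 :\: step B k)%VS.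
  have AS := stepS A kp; have BS := stepS B kp.
  have dD : \dim D = \dim D'.
    have := dimv_cap_compl (step A k.+1) (step A k).
    have := dimv_cap_compl (step B k.+1) (step B k).
    move/capv_idPr: AS => ->; move/capv_idPr: BS => ->.
    by rewrite !ed => <- /addnI.
  have [th thD] := lfun_onto dD.
  have DU : (D :&: U = 0)%VS := capv_diff _ _.
  have UD : (U :&: D = 0)%VS by rewrite capvC.
  pose g' : 'Hom(V, W) := (g \o daddv_pi U D)%VF + (th \o daddv_pi D U)%VF.
  have g'U x : x \in U -> g' x = g x.
    move=> xU; rewrite /g' add_lfunE !comp_lfunE daddv_pi_id //.
    have := daddv_pi_add UD (subvP (addvSl U D) _ xU).
    by rewrite daddv_pi_id // -[RHS]addr0 => /addrI->; rewrite linear0 addr0.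
  have g'D x : x \in D -> g' x = th x.
    move=> xD; rewrite /g' add_lfunE !comp_lfunE [daddv_pi D U x]daddv_pi_id //.
    have := daddv_pi_add UD (subvP (addvSr U D) _ xD).
    rewrite [daddv_pi D U x]daddv_pi_id // -[RHS]add0r => /addIr->.
    by rewrite linear0 add0r.
  exists g' => j; rewrite leq_eqVlt => /predU1P[->|].
    have -> : step A k.+1 = (U + D)%VS by rewrite addvC addv_diff; apply/esym/addv_idPl.
    rewrite limgD (eq_in_limg g'U) (eq_in_limg g'D) gAB // thD.
    by rewrite addvC addv_diff; apply/addv_idPl.
  rewrite ltnS => jk; rewrite -gAB //; apply: eq_in_limg => x xj; apply: g'U.
  exact: subvP (step_le A jk (ltnW kp)) _ xj.
exists g; last by move=> i; rewrite !stepE gAB // leq_ord.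
(* [g] maps onto a space of the same dimension, hence is injective. *)
have := limg_ker_dim g fullv; rewrite capfv -(step_max A) gAB // -ed.
by rewrite -[X in _ = X -> _]add0n => /addIn/eqP; rewrite dimv_eq0.
Qed.

(* The map is extended step by step: from A_k + K to A_(k+1) + K by 0 on a
   complement of (A_k + K) :&: A_(k+1) in A_(k+1). *)
Lemma flag_ext V L p (A : flag V p) (B : flag L p) (K : {vspace V})
    (f : 'Hom(V, L)) :
  (forall i x, x \in K -> x \in A i -> f x \in B i) ->
  exists2 rho : 'Hom(V, L), {in K, rho =1 f} &
    forall i x, x \in A i -> rho x \in B i.
Proof.
move=> fK.
have fKs k x : (k <= p)%N -> x \in K -> x \in step A k -> f x \in step B k.
  by move=> kp; exact: fK.
suff: forall k, (k <= p)%N -> exists2 rho : 'Hom(V, L), {in K, rho =1 f} &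
    forall j x, (j <= k)%N -> x \in step A j -> rho x \in step B j.
  move=> /(_ p (leqnn _)) [rho h1 h2]; exists rho => // i x.
  by rewrite !stepE => /h2; apply; rewrite leq_ord.
elim=> [|k IH] kp.
  exists f => // j x; rewrite leqn0 => /eqP->; rewrite step0 memv0 => /eqP->.
  by rewrite linear0 mem0v.
have [rho rhoK rhoA] := IH (ltnW kp).
have AS := stepS A kp; have BS := stepS B kp.
pose U := (step A k + K)%VS; pose E := (step A k.+1 :\: (U :&: step A k.+1))%VS.
have EU : (U :&: E = 0)%VS.
  apply/eqP; rewrite -subv0; apply/subvP => x; rewrite memv_cap => /andP[xU xE].
  rewrite -(capv_diff (step A k.+1) (U :&: step A k.+1)) memv_cap xE /=.
  by rewrite memv_cap xU (subvP (diffvSl _ _) _ xE).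
pose rho' := (rho \o daddv_pi U E)%VF.
have rho'U x : x \in U -> rho' x = rho x.
  by move=> xU; rewrite comp_lfunE daddv_pi_id.
have rho'E x : x \in E -> rho' x = 0.
  move=> xE; rewrite /rho' comp_lfunE; have := daddv_pi_add EU (subvP (addvSr U E) _ xE).
  rewrite [daddv_pi E U x]daddv_pi_id ?[(E :&: U)%VS]capvC // -[RHS]add0r => /addIr->.
  by rewrite linear0.
exists rho' => [x xK|j x].
  by rewrite rho'U ?rhoK //; apply: subvP (addvSr _ _) _ xK.
rewrite leq_eqVlt => /predU1P[->|].
  move=> xA; have : x \in (E + U :&: step A k.+1)%VS.
    rewrite addv_diff; exact: subvP (addvSl _ _) _ xA.
  case/memv_addP => e eE [u]; rewrite memv_cap => /andP[uU uA] xe.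
  rewrite xe linearD /= rho'E // add0r rho'U //.
  case/memv_addP: (uU) => a aA [b bK] ue; rewrite ue linearD memvD //=.
    exact: subvP BS _ (rhoA _ _ (leqnn _) aA).
  rewrite rhoK //; apply: fKs => //.
  have -> : b = u - a by rewrite ue addrC addKr.
  by rewrite memvB // (subvP AS).
rewrite ltnS => jk xA; rewrite rho'U ?rhoA //.
by apply: subvP (addvSl _ _) _ _; apply: subvP (step_le A jk (ltnW kp)) _ xA.
Qed.

(** * Filtered maps between two flags and their dimension *)

Definition fhom_spec V W p (A : flag V p) (B : flag W p) (f : 'Hom(V, W)) :=
  forall i x, x \in A i -> f x \in B i.

Lemma fhom_ex V W p (A : flag V p) (B : flag W p) :
  exists U : {vspace 'Hom(V, W)}, forall f, f \in U <-> fhom_spec A B f.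
Proof.
apply: vspace_of_closed => [i x _|a u v hu hv i x xA].
  by rewrite zero_lfunE mem0v.
by rewrite add_lfunE scale_lfunE memvD // ?memvZ ?hu ?hv.
Qed.

(** For [A = B] this is the parabolic subalgebra that stabilises the flag. *)
Definition fhom V W p (A : flag V p) (B : flag W p) : {vspace 'Hom(V, W)} :=
  projT1 (cid (fhom_ex A B)).

Lemma fhomP V W p (A : flag V p) (B : flag W p) (f : 'Hom(V, W)) :
  reflect (forall i x, x \in A i -> f x \in B i) (f \in fhom A B).
Proof. by apply: (iffP idP) => /(projT2 (cid (fhom_ex A B)) f). Qed.

Lemma fhom_step V W p (A : flag V p) (B : flag W p) (f : 'Hom(V, W)) k x :
  f \in fhom A B -> x \in step A k -> f x \in step B k.
Proof. by move/fhomP => h; exact: h. Qed.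

Lemma fhom_stepP V W p (A : flag V p) (B : flag W p) (f : 'Hom(V, W)) :
  (forall k x, (k <= p)%N -> x \in step A k -> f x \in step B k) -> f \in fhom A B.
Proof.
by move=> h; apply/fhomP => i x; rewrite !stepE; apply: h; rewrite leq_ord.
Qed.

(** [H] is a copy of Hom(D, B): restrict to [D] in one direction, extend by zero on the complement
    [D^C] in the other. *)
Lemma dim_maps_between V W (D : {vspace V}) (B : {vspace W})
    (H : {vspace 'Hom(V, W)}) :
  (forall h, h \in H <-> (forall x, x \in D^C%VS -> h x = 0) /\
                         (forall x, x \in D -> h x \in B)) ->
  \dim H = (\dim D * \dim B)%N.
Proof.
move=> HP.
have [Th ThE] : exists Th : 'Hom('Hom(subvs_of D, subvs_of B), 'Hom(V, W)),
    forall h x, Th h x = vsval (h (vsproj D x)).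
  pose f (h : 'Hom(subvs_of D, subvs_of B)) : 'Hom(V, W) :=
    (linfun vsval \o h \o linfun (vsproj D))%VF.
  have [|Th ThE] := @lfun_of_linear _ _ _ f.
    move=> a u v; apply/lfunP => x.
    by rewrite /f !(add_lfunE, scale_lfunE, comp_lfunE) !lfunE.
  by exists Th => h x; rewrite ThE /f !comp_lfunE !lfunE.
have kTh : lker Th = 0%VS.
  apply/eqP; rewrite -subv0; apply/subvP => h; rewrite memv_ker memv0 => /eqP h0.
  apply/eqP/lfunP => x; apply: subvs_inj; rewrite -[x]vsvalK -ThE h0.
  by rewrite !zero_lfunE linear0.
have -> : H = limg Th.
  apply/vspaceP => h; apply/idP/memv_imgP => [/HP[h1 h2]|[g _ ->]]; last first.
    apply/HP; split=> x xD; rewrite ThE ?subvsP //.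
    have -> : vsproj D x = 0.
      by apply: subvs_inj; rewrite /= unlock /=; apply/eqP; rewrite -memv_ker lker_proj.
    by rewrite !linear0.
  have [h' h'E] : exists h' : 'Hom(subvs_of D, subvs_of B),
      forall x, h' x = vsproj B (h (vsval x)).
    by apply: lfun_of_linear => a u v; rewrite !(linearD, linearZ).
  exists h'; rewrite ?memvf //; apply/lfunP => x; rewrite ThE h'E vsprojK; last first.
    by apply: h2; rewrite subvsP.
  have -> : vsval (vsproj D x) = projv D x by rewrite unlock.
  apply/eqP; rewrite -subr_eq0 -linearB; apply/eqP; apply: h1; exact: memv_projC.
rewrite limg_dim_eq ?kTh ?capv0 // dimvf //.
Qed.

(* The maps vanishing on A_k filter fhom A B; the successive quotients are the
   spaces of maps from a complement of A_k in A_(k+1) to B_(k+1). *)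
Lemma dim_fhom V W p (A : flag V p) (B : flag W p) :
  \dim (fhom A B) = (\sum_(i < p) flag_type A i * \dim (B (hi i)))%N.
Proof.
pose a k := (\dim (step A k.+1) - \dim (step A k))%N.
have restr_ex (U : {vspace V}) : exists r : 'End('Hom(V, W)),
    forall f, r f = (f \o projv U)%VF.
  apply: lfun_of_linear => c u v; apply/lfunP => x.
  by rewrite !(add_lfunE, scale_lfunE, comp_lfunE).
pose restr (U : {vspace V}) := projT1 (cid (restr_ex U)).
have restrE (U : {vspace V}) f : restr U f = (f \o projv U)%VF := projT2 (cid (restr_ex U)) f.
have restrK (U : {vspace V}) f : f \in lker (restr U) <-> forall x, x \in U -> f x = 0.
  rewrite memv_ker restrE; split=> [/eqP/lfunP h x xU | h].
    by have := h x; rewrite comp_lfunE projv_id // zero_lfunE.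
  by apply/eqP/lfunP => x; rewrite comp_lfunE zero_lfunE h // memv_proj.
pose R k := (fhom A B :&: lker (restr (step A k)))%VS.
have RP k f : f \in R k <-> f \in fhom A B /\ forall x, x \in step A k -> f x = 0.
  rewrite memv_cap; split; first by case/andP=> ? /restrK.
  by case=> -> /restrK.
have main k : (k <= p)%N ->
    \dim (fhom A B) = (\sum_(0 <= j < k) a j * \dim (step B j.+1) + \dim (R k))%N.
  elim: k => [|k IH] kp.
    rewrite big_nil add0n; congr (\dim _); apply/vspaceP => f; apply/idP/idP.
      move=> hf; apply/RP; split=> // x; rewrite step0 memv0 => /eqP->.
      exact: linear0.
    by case/RP.
  rewrite (IH (ltnW kp)) big_nat_recr //= -addnA; congr (_ + _)%N.
  have AS := stepS A kp; have BS := stepS B kp.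
  pose D := (step A k.+1 :\: step A k)%VS.
  have AD : (D + step A k = step A k.+1)%VS by rewrite addv_diff; apply/addv_idPl.
  rewrite -(limg_ker_dim (restr D) (R k)) addnC; congr (_ + _)%N; last first.
    congr (\dim _); apply/vspaceP => f; rewrite memv_cap; apply/andP/idP.
      case=> /RP[hf h1] /restrK h2; apply/RP; split=> // x.
      by rewrite -AD => /memv_addP[d dD [e eA ->]]; rewrite linearD /= (h2 d dD) (h1 e eA) addr0.
    case/RP => hf h1; split; last first.
      by apply/restrK => x xD; apply: h1; rewrite -AD (subvP (addvSl _ _)).
    by apply/RP; split=> // x xA; apply: h1; rewrite (subvP AS).
  have -> : a k = \dim D.
    rewrite /a -(dimv_cap_compl (step A k.+1) (step A k)).
    by move/capv_idPr: AS => ->; rewrite addKn.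
  apply: dim_maps_between => h; split.
    case/memv_imgP => f /RP[hf f0] ->; rewrite restrE; split=> x xD; rewrite comp_lfunE.
      suff /eqP -> : projv D x == 0 by rewrite linear0.
      by rewrite -memv_ker lker_proj.
    by rewrite projv_id //; apply: (fhom_step hf); rewrite -AD (subvP (addvSl _ _)).
  case=> h1 h2.
  (* A complement of [D] that contains A_k: composing [h] with the projection to [D] along [U] gives
     a filtered map that kills A_k and agrees with [h] on [D]. *)
  pose U := (step A k + (step A k.+1)^C)%VS.
  have DU : (D :&: U = 0)%VS.
    apply/eqP; rewrite -subv0; apply/subvP => x; rewrite memv_cap => /andP[xD].
    case/memv_addP => y yA [z zC] xyz.
    have z0 : z = 0.
      apply/eqP; rewrite -memv0 -(capv_compl (step A k.+1)) memv_cap zC andbT.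
      have -> : z = x - y by rewrite xyz addrC addKr.
      by rewrite memvB // -AD ?(subvP (addvSl _ _) _ xD) ?(subvP (addvSr _ _) _ yA).
    move: xyz; rewrite z0 addr0 => xy.
    by rewrite -(capv_diff (step A k.+1) (step A k)) memv_cap xD xy.
  have UD : (U :&: D = 0)%VS by rewrite capvC.
  apply/memv_imgP; exists (h \o daddv_pi D U)%VF.
    have kU x : x \in U -> daddv_pi D U x = 0.
      move=> xU; have := daddv_pi_add DU (subvP (addvSr D U) _ xU).
      by rewrite [daddv_pi U D x]daddv_pi_id // -[RHS]add0r => /addIr->.
    apply/RP; split; last first.
      by move=> x xA; rewrite comp_lfunE kU ?linear0 // (subvP (addvSl _ _)).
    apply: fhom_stepP => j x jp xA; rewrite comp_lfunE; have [jk|kj] := leqP j k.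
      rewrite kU ?linear0 ?mem0v //; apply: subvP (addvSl _ _) _ _.
      exact: subvP (step_le A jk (ltnW kp)) _ xA.
    apply: subvP (step_le B kj jp) _ _; apply: h2; exact: memv_pi.
  apply/lfunP => x; rewrite restrE !comp_lfunE daddv_pi_id ?memv_proj //.
  by apply/eqP; rewrite -subr_eq0 -linearB; apply/eqP; apply: h1; exact: memv_projC.
rewrite (main p) // big_mkord.
have -> : R p = 0%VS.
  apply/eqP; rewrite -subv0; apply/subvP => f /RP[_ f0]; rewrite memv0.
  by apply/eqP/lfunP => x; rewrite zero_lfunE f0 // step_max memvf.
rewrite dimv0 addn0; apply: eq_bigr => i _.
by rewrite flag_typeE hiE.
Qed.

(** The dimension of a parabolic subalgebra, doubled to stay in the natural numbers. Each step of
    the flag uses [(s + a)^2 + a^2 = s^2 + 2 a (s + a)]. *)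
Lemma dim_fhom_self V p (A : flag V p) :
  (2 * \dim (fhom A A) = \dim {:V} ^ 2 + csqnorm (flag_type A))%N.
Proof.
rewrite dim_fhom -(step_max A).
have main k : (k <= p)%N ->
    (2 * \sum_(i < p | (i < k)%N) flag_type A i * \dim (A (hi i)) =
     \dim (step A k) ^ 2 + \sum_(i < p | (i < k)%N) flag_type A i ^ 2)%N.
  elim: k => [|k IH] kp.
    by rewrite !big_pred0 // step0 dimv0.
  rewrite !(bigD1 (P := fun i : 'I_p => (i < k.+1)%N) (Ordinal kp)) //=.
  have ek (i : 'I_p) : (i < k.+1)%N && (i != Ordinal kp) = (i < k)%N.
    by rewrite -val_eqE /= ltnS ltn_neqAle andbC.
  rewrite !(eq_bigl _ _ ek) mulnDr (IH (ltnW kp)) flag_typeE /= hiE /=.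
  rewrite -(subnK (dimvS (stepS A kp))) addnK.
  rewrite !mulnDr -!mulnn; ring.
have := main p (leqnn _).
have ep (i : 'I_p) : (i < p)%N = true by exact: ltn_ord.
by rewrite !(eq_bigl _ _ ep).
Qed.

End SingleFlags.

(** * The category of triple flags *)

Section Category.
Variables (F : fieldType) (p q r : nat).
Local Notation obj := (obj F p q r).
Implicit Types X Y Z L K : obj.

Definition homs X Y : {vspace 'Hom(ospace X, ospace Y)} :=
  (fhom (flagA X) (flagA Y) :&: (fhom (flagB X) (flagB Y) :&: fhom (flagC X) (flagC Y)))%VS.

Lemma homsP X Y (f : 'Hom(ospace X, ospace Y)) :
  reflect [/\ forall i x, x \in flagA X i -> f x \in flagA Y i,
              forall i x, x \in flagB X i -> f x \in flagB Y i
            & forall i x, x \in flagC X i -> f x \in flagC Y i]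
          (f \in homs X Y).
Proof.
rewrite !memv_cap; apply: (iffP and3P) => -[].
  by move=> /fhomP hA /fhomP hB /fhomP hC.
by move=> hA hB hC; split; apply/fhomP.
Qed.

Lemma is_morphE X Y (f : 'Hom(ospace X, ospace Y)) : is_morph f <-> f \in homs X Y.
Proof.
have sub (V W : vectType F) (g : 'Hom(V, W)) U U' :
    (g @: U <= U')%VS <-> (forall x, x \in U -> g x \in U').
  split=> [/subvP h x xU|h]; first by apply: h; apply: memv_img.
  by apply/subvP => _ /memv_imgP[x xU ->]; apply: h.
split=> [[hA hB hC]|/homsP[hA hB hC]].
  by apply/homsP; split=> i; apply/sub.
by split=> i; apply/sub; [apply: hA|apply: hB|apply: hC].
Qed.

Lemma homs_comp X Y Z (f : 'Hom(ospace X, ospace Y)) (g : 'Hom(ospace Y, ospace Z)) :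
  f \in homs X Y -> g \in homs Y Z -> (g \o f)%VF \in homs X Z.
Proof.
move=> /homsP[fA fB fC] /homsP[gA gB gC].
by apply/homsP; split=> i x h; rewrite comp_lfunE; [apply/gA/fA|apply/gB/fB|apply/gC/fC].
Qed.

Lemma homs_id X : \1%VF \in homs X X.
Proof. by apply/homsP; split=> i x; rewrite id_lfunE. Qed.

Lemma morph_ex X Y (h : ospace X -> ospace Y) : linear h ->
  (forall i x, x \in flagA X i -> h x \in flagA Y i) ->
  (forall i x, x \in flagB X i -> h x \in flagB Y i) ->
  (forall i x, x \in flagC X i -> h x \in flagC Y i) ->
  exists2 f : 'Hom(ospace X, ospace Y), f \in homs X Y & f =1 h.
Proof.
move=> /lfun_of_linear[f fE] hA hB hC; exists f => //.
by apply/homsP; split=> i x; rewrite fE; [apply: hA|apply: hB|apply: hC].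
Qed.

Lemma isoP X Y : iso X Y <->
  exists (f : 'Hom(ospace X, ospace Y)) (g : 'Hom(ospace Y, ospace X)),
    [/\ f \in homs X Y, g \in homs Y X, cancel f g & cancel g f].
Proof.
split=> -[f [g []]].
  move=> /is_morphE hf /is_morphE hg /lfunP gf /lfunP fg; exists f, g; split=> // x.
    by have := gf x; rewrite comp_lfunE id_lfunE.
  by have := fg x; rewrite comp_lfunE id_lfunE.
move=> /is_morphE hf /is_morphE hg gf fg; exists f, g; split=> //.
  by apply/lfunP => x; rewrite comp_lfunE id_lfunE.
by apply/lfunP => x; rewrite comp_lfunE id_lfunE.
Qed.

Lemma iso_ex X Y (h : ospace X -> ospace Y) (k : ospace Y -> ospace X) :
  linear h -> cancel h k -> cancel k h ->
  (forall i x, (h x \in flagA Y i) = (x \in flagA X i)) ->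
  (forall i x, (h x \in flagB Y i) = (x \in flagB X i)) ->
  (forall i x, (h x \in flagC Y i) = (x \in flagC X i)) -> iso X Y.
Proof.
move=> lh hk kh hA hB hC; apply/isoP.
have lk : linear k by move=> a u v; apply: (can_inj hk); rewrite lh !kh.
have [|||f fm fE] := morph_ex lh; try by move=> i x; rewrite ?hA ?hB ?hC.
have [|||g gm gE] := morph_ex lk.
- by move=> i x; rewrite -[x in X in X -> _]kh hA.
- by move=> i x; rewrite -[x in X in X -> _]kh hB.
- by move=> i x; rewrite -[x in X in X -> _]kh hC.
by exists f, g; split=> // x; rewrite fE gE ?hk ?kh.
Qed.

Lemma iso_refl X : iso X X.
Proof. exact: (@iso_ex X X idfun idfun). Qed.

Lemma iso_sym X Y : iso X Y -> iso Y X.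
Proof. by move=> /isoP[f [g [? ? ? ?]]]; apply/isoP; exists g, f. Qed.

Lemma iso_trans X Y Z : iso X Y -> iso Y Z -> iso X Z.
Proof.
move=> /isoP[f [g [fm gm gf fg]]] /isoP[f' [g' [fm' gm' gf' fg']]].
apply/isoP; exists (f' \o f)%VF, (g \o g')%VF; split.
- exact: homs_comp fm fm'.
- exact: homs_comp gm' gm.
- by move=> x; rewrite !comp_lfunE gf' gf.
- by move=> x; rewrite !comp_lfunE fg fg'.
Qed.

Lemma lker0_cancel (V W : vectType F) (f : 'Hom(V, W)) (g : 'Hom(W, V)) :
  cancel f g -> lker f == 0%VS.
Proof. by move=> fg; apply/lker0P; apply: can_inj fg. Qed.

Lemma iso_dims X Y : iso X Y ->
  [/\ forall i, \dim (flagA X i) = \dim (flagA Y i),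
      forall i, \dim (flagB X i) = \dim (flagB Y i)
    & forall i, \dim (flagC X i) = \dim (flagC Y i)].
Proof.
suff h Z T : iso Z T -> [/\ forall i, (\dim (flagA Z i) <= \dim (flagA T i))%N,
      forall i, (\dim (flagB Z i) <= \dim (flagB T i))%N
    & forall i, (\dim (flagC Z i) <= \dim (flagC T i))%N].
  move=> XY; have [a b c] := h _ _ XY; have [a' b' c'] := h _ _ (iso_sym XY).
  by split=> i; apply/eqP; rewrite eqn_leq ?a ?b ?c ?a' ?b' ?c'.
move=> /isoP[f [g [fm gm /lker0_cancel/eqP f0 _]]].
have [fA fB fC] := (elimT (homsP f) fm).
by split=> i; rewrite -(@limg_dim_eq _ _ _ f) ?f0 ?capv0 //; apply: dimvS;
  apply/subvP => _ /memv_imgP[x xi ->]; [apply: fA|apply: fB|apply: fC].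
Qed.

Lemma iso_dimvec X Y : iso X Y -> dimvec X = dimvec Y.
Proof.
by move=> /iso_dims[a b c]; rewrite /dimvec; congr (_, _, _); apply: eq_flag_type.
Qed.

Lemma iso_dim X Y : iso X Y -> \dim {:ospace X} = \dim {:ospace Y}.
Proof.
move=> /iso_dimvec e; rewrite -(csize_flag_type (flagA X)) -(csize_flag_type (flagA Y)).
by case: e => ->.
Qed.

(** A bijective morphism need not be invertible in this category. Equality of the dimension vectors
    makes [f] carry every step of each flag onto the corresponding step, so the inverse map is
    filtered too. *)
Lemma homs_inv X Y (f : 'Hom(ospace X, ospace Y)) :
  f \in homs X Y -> lker f == 0%VS -> dimvec X = dimvec Y ->
  [/\ f^-1%VF \in homs Y X, cancel f f^-1%VF & cancel f^-1%VF f].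
Proof.
move=> /homsP[fA fB fC] f0 [eA eB eC].
have onto : cancel f^-1%VF f.
  move=> y; apply: limg_lfunVK; suff -> : limg f = fullv by apply: memvf.
  apply/eqP; rewrite eqEdim subvf limg_dim_eq ?(eqP f0) ?capv0 //.
  by rewrite -(csize_flag_type (flagA X)) -(csize_flag_type (flagA Y)) eA leqnn.
have fK := lker0_lfunK f0.
have inv (U : {vspace ospace X}) (U' : {vspace ospace Y}) x :
    (forall y, y \in U -> f y \in U') -> \dim U = \dim U' -> x \in U' -> f^-1%VF x \in U.
  move=> fU dU; have <- : (f @: U)%VS = U'.
    apply/eqP; rewrite eqEdim -dU limg_dim_eq ?(eqP f0) ?capv0 // leqnn andbT.
    by apply/subvP => _ /memv_imgP[y yU ->]; apply: fU.
  by case/memv_imgP=> y yU ->; rewrite fK.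
split=> //; apply/homsP; split=> i x.
- by apply: inv (@fA i) _; apply: eq_dim_step.
- by apply: inv (@fB i) _; apply: eq_dim_step.
- by apply: inv (@fC i) _; apply: eq_dim_step.
Qed.

Lemma iso_bij X Y (f : 'Hom(ospace X, ospace Y)) :
  f \in homs X Y -> lker f == 0%VS -> dimvec X = dimvec Y -> iso X Y.
Proof.
move=> fm f0 e; have [gm fg gf] := homs_inv fm f0 e.
by apply/isoP; exists f, f^-1%VF.
Qed.

Lemma iso_zero X : iso X (zero_obj F p q r) <-> \dim {:ospace X} = 0%N.
Proof.
split=> [/iso_dim->|d0]; first by rewrite dimvf /dim /= muln0.
have x0 (x : ospace X) : x = 0.
  apply/eqP; rewrite -memv0; have /eqP <- : (fullv : {vspace ospace X}) == 0%VS.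
    by rewrite -dimv_eq0 d0.
  exact: memvf.
have v0 (x : 'rV[F]_0) : x = 0 by rewrite [x]thinmx0.
apply: (@iso_ex X (zero_obj F p q r) (fun=> 0) (fun=> 0)).
- by move=> a u v; rewrite scaler0 addr0.
- by move=> x; rewrite [RHS]x0.
- by move=> x; rewrite [RHS]v0.
- by move=> i x; rewrite (x0 x) !mem0v.
- by move=> i x; rewrite (x0 x) !mem0v.
- by move=> i x; rewrite (x0 x) !mem0v.
Qed.

Lemma iso_zeroP X : iso X (zero_obj F p q r) <-> forall x : ospace X, x = 0.
Proof.
rewrite iso_zero; split=> [/eqP|x0].
  by rewrite dimv_eq0 => /eqP f0 x; apply/eqP; rewrite -memv0 -f0 memvf.
by apply/eqP; rewrite dimv_eq0 -subv0; apply/subvP => x _; rewrite (x0 x) mem0v.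
Qed.

Lemma mem_dsumA X Y i x :
  (x \in flagA (dsum X Y) i) = (x.1 \in flagA X i) && (x.2 \in flagA Y i).
Proof. by rewrite /= ffunE mem_vsum. Qed.

Lemma mem_dsumB X Y i x :
  (x \in flagB (dsum X Y) i) = (x.1 \in flagB X i) && (x.2 \in flagB Y i).
Proof. by rewrite /= ffunE mem_vsum. Qed.

Lemma mem_dsumC X Y i x :
  (x \in flagC (dsum X Y) i) = (x.1 \in flagC X i) && (x.2 \in flagC Y i).
Proof. by rewrite /= ffunE mem_vsum. Qed.

Definition mem_dsum := (mem_dsumA, mem_dsumB, mem_dsumC).

Lemma dsum_comm X Y : iso (dsum X Y) (dsum Y X).
Proof.
apply: (@iso_ex (dsum X Y) (dsum Y X) (fun x => (x.2, x.1)) (fun x => (x.2, x.1))) => //.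
- by case.
- by case.
- by move=> i x; rewrite !mem_dsum andbC.
- by move=> i x; rewrite !mem_dsum andbC.
- by move=> i x; rewrite !mem_dsum andbC.
Qed.

Lemma dsum_assoc X Y Z : iso (dsum X (dsum Y Z)) (dsum (dsum X Y) Z).
Proof.
apply: (@iso_ex (dsum X (dsum Y Z)) (dsum (dsum X Y) Z)
  (fun x => ((x.1, x.2.1), x.2.2)) (fun x => (x.1.1, (x.1.2, x.2)))) => //.
- by case=> ? [].
- by case=> -[].
- by move=> i x; rewrite !mem_dsum andbA.
- by move=> i x; rewrite !mem_dsum andbA.
- by move=> i x; rewrite !mem_dsum andbA.
Qed.

Lemma dsum_iso X X' Y Y' : iso X X' -> iso Y Y' -> iso (dsum X Y) (dsum X' Y').
Proof.
move=> /isoP[f [g [/homsP[fA fB fC] /homsP[gA gB gC] gf fg]]].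
move=> /isoP[f' [g' [/homsP[fA' fB' fC'] /homsP[gA' gB' gC'] gf' fg']]].
have inv (U V : vectType F) (h : 'Hom(U, V)) (k : 'Hom(V, U)) (S : {vspace U})
    (T : {vspace V}) x : cancel h k -> (forall x, x \in S -> h x \in T) ->
    (forall x, x \in T -> k x \in S) -> (h x \in T) = (x \in S).
  by move=> hk hS kT; apply/idP/idP => [/kT|/hS //]; rewrite hk.
apply: (@iso_ex (dsum X Y) (dsum X' Y') (fun x => (f x.1, f' x.2)) (fun x => (g x.1, g' x.2))).
- by move=> a u v; congr (_, _); rewrite /= linearP.
- by case=> x y /=; rewrite gf gf'.
- by case=> x y /=; rewrite fg fg'.
- by move=> i x; rewrite !mem_dsum; congr andb; apply: inv; eauto.
- by move=> i x; rewrite !mem_dsum; congr andb; apply: inv; eauto.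
- by move=> i x; rewrite !mem_dsum; congr andb; apply: inv; eauto.
Qed.

Lemma dsum_zerol Z X : iso Z (zero_obj F p q r) -> iso (dsum Z X) X.
Proof.
move=> /iso_zeroP z0.
apply: (@iso_ex (dsum Z X) X snd (fun x => (0, x))) => //.
- by case=> x y /=; rewrite (z0 x).
- by move=> i x; rewrite !mem_dsum (z0 x.1) mem0v.
- by move=> i x; rewrite !mem_dsum (z0 x.1) mem0v.
- by move=> i x; rewrite !mem_dsum (z0 x.1) mem0v.
Qed.

Lemma dim_dsum X Y :
  \dim {:ospace (dsum X Y)} = (\dim {:ospace X} + \dim {:ospace Y})%N.
Proof. by rewrite !dimvf. Qed.

Lemma dimvec_dsum X Y : dimvec (dsum X Y) = dimvec X + dimvec Y.
Proof.
have ft k (V1 V2 : vectType F) (A : flag V1 k) (B : flag V2 k) (C : flag _ k) :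
    (forall i, C i = vsum (A i) (B i)) -> flag_type C = flag_type A + flag_type B.
  move=> CE; apply/ffunP => i; rewrite !ffunE !CE !dim_vsum.
  have := dimvS (stepS A (ltn_ord i)); have := dimvS (stepS B (ltn_ord i)).
  rewrite !loE !hiE => h1 h2; rewrite -[RHS]/(_ + _)%N; lia.
by rewrite /dimvec; congr (_, _, _); apply: ft => i; rewrite /= ffunE.
Qed.

Lemma dimvec_zero : dimvec (zero_obj F p q r) = 0.
Proof.
by rewrite /dimvec; congr (_, _, _); apply/ffunP => i; rewrite !ffunE /= ?ffunE !dimv0.
Qed.

Lemma dimvec_Lambda X : Lambda (dimvec X).
Proof. by split; rewrite /= !csize_flag_type. Qed.

End Category.

(** * Krull-Schmidt decompositions *)

Section Decomposition.
Variables (F : fieldType) (p q r : nat).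
Local Notation obj := (obj F p q r).
Implicit Types X Y Z L K : obj.

Lemma subflag_subproof (V : vectType F) k (A : flag V k) (U : {vspace V}) :
  is_flag [ffun i => (linfun (@vsval _ _ U) @^-1: A i)%VS].
Proof.
have memE i x : (x \in (linfun (@vsval _ _ U) @^-1: A i)%VS) = (vsval x \in A i).
  by rewrite -memv_preim lfunE.
have /and3P[/eqP A0 /eqP Am /forallP AS] := flag_valP A.
apply/and3P; split; rewrite ?ffunE.
- by rewrite -subv0; apply/subvP => x; rewrite memE A0 !memv0.
- by apply/eqP/vspaceP => x; rewrite memE Am !memvf.
- apply/forallP => i; rewrite !ffunE; apply/subvP => x; rewrite !memE.
  exact: subvP (AS i) _.
Qed.

(** The induced structure: the intersections of the flags with [U], written as preimages under the
    inclusion. *)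
Definition subobj X (U : {vspace ospace X}) : obj :=
  Obj (Flag (subflag_subproof (flagA X) U)) (Flag (subflag_subproof (flagB X) U))
      (Flag (subflag_subproof (flagC X) U)).

Lemma mem_subobjA X (U : {vspace ospace X}) i (x : subvs_of U) :
  (x \in flagA (subobj U) i) = (vsval x \in flagA X i).
Proof. by rewrite /= ffunE -memv_preim lfunE. Qed.

Lemma mem_subobjB X (U : {vspace ospace X}) i (x : subvs_of U) :
  (x \in flagB (subobj U) i) = (vsval x \in flagB X i).
Proof. by rewrite /= ffunE -memv_preim lfunE. Qed.

Lemma mem_subobjC X (U : {vspace ospace X}) i (x : subvs_of U) :
  (x \in flagC (subobj U) i) = (vsval x \in flagC X i).
Proof. by rewrite /= ffunE -memv_preim lfunE. Qed.

Definition mem_subobj := (mem_subobjA, mem_subobjB, mem_subobjC).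

Lemma dim_subobj X (U : {vspace ospace X}) : \dim {:ospace (subobj U)} = \dim U.
Proof. by rewrite dimvf. Qed.

Lemma homs_vsval X (U : {vspace ospace X}) :
  exists2 j : 'Hom(ospace (subobj U), ospace X), j \in homs (subobj U) X & j =1 vsval.
Proof. by apply: morph_ex => // i x; rewrite mem_subobj. Qed.

(** In [x = j (s x) + (x - j (s x))] both terms stay in every step of a flag that contains [x], so
    the splitting respects all three flags. *)
Lemma split_retraction X Y (j : 'Hom(ospace Y, ospace X)) (s : 'Hom(ospace X, ospace Y)) :
  j \in homs Y X -> s \in homs X Y -> cancel j s -> iso X (dsum Y (subobj (lker s))).
Proof.
move=> /homsP[jA jB jC] /homsP[sA sB sC] js.
have kerE x : x - j (s x) \in lker s by rewrite memv_ker linearB /= js subrr.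
have memE (S : {vspace ospace X}) (T : {vspace ospace Y}) x :
    (forall x, x \in S -> s x \in T) -> (forall y, y \in T -> j y \in S) ->
    (s x \in T) && (vsval (vsproj (lker s) (x - j (s x))) \in S) = (x \in S).
  move=> sS jT; rewrite vsprojK //; apply/andP/idP => [[h1 h2]|xS].
    by rewrite -(subrK (j (s x)) x) memvD // jT.
  by rewrite sS // memvB // jT // sS.
apply: (@iso_ex _ _ _ _ X (dsum Y (subobj (lker s)))
  (fun x => (s x, vsproj (lker s) (x - j (s x)))) (fun y => j y.1 + vsval y.2)).
- have kE x : x - j (s x) = (\1%VF - (j \o s)%VF) x.
    by rewrite add_lfunE opp_lfunE comp_lfunE id_lfunE.
  by move=> a u v; rewrite !kE !linearP.
- by move=> x /=; rewrite vsprojK // addrC subrK.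
- case=> y z /=; have -> : s (j y + vsval z) = y.
    rewrite linearD /= js; have := subvsP z; rewrite memv_ker => /eqP->.
    by rewrite addr0.
  by rewrite addrC addKr vsvalK.
- by move=> i x; rewrite mem_dsum mem_subobj /=; apply: memE; [apply: sA|apply: jA].
- by move=> i x; rewrite mem_dsum mem_subobj /=; apply: memE; [apply: sB|apply: jB].
- by move=> i x; rewrite mem_dsum mem_subobj /=; apply: memE; [apply: sC|apply: jC].
Qed.

Lemma indecomposable_retraction X Y (j : 'Hom(ospace Y, ospace X))
    (s : 'Hom(ospace X, ospace Y)) :
  indecomposable X -> j \in homs Y X -> s \in homs X Y -> cancel j s ->
  (forall y : ospace Y, y = 0) \/ cancel s j.
Proof.
move=> [_ Xind] jm sm js.
have [/iso_zeroP|/iso_zeroP z0] := Xind _ _ (split_retraction jm sm js); first by left.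
right=> x; apply/esym/eqP; rewrite -subr_eq0.
have xk : x - j (s x) \in lker s by rewrite memv_ker linearB /= js subrr.
by rewrite -[x - _](vsprojK xk) (z0 (vsproj _ _)) linear0.
Qed.

Lemma homs_iter X (f : 'End(ospace X)) n : f \in homs X X ->
  exists2 g : 'End(ospace X), g \in homs X X & forall x, g x = iter n f x.
Proof.
move=> fm; elim: n => [|n [g gm gE]]; first by exists \1%VF; rewrite ?homs_id // => x; rewrite id_lfunE.
by exists (f \o g)%VF; [apply: homs_comp | move=> x; rewrite comp_lfunE gE].
Qed.

(* Fitting's lemma. *)
Lemma indecomposable_endo X (f : 'End(ospace X)) :
  indecomposable X -> f \in homs X X ->
  lker f == 0%VS \/ exists N, forall x, iter N f x = 0.
Proof.
move=> Xind fm.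
(* A power [g] of [f] of least rank has the same rank as its square, so its image and kernel are
   complementary. *)
pose rk n d := exists2 g : 'End(ospace X), (forall x, g x = iter n f x) & \dim (limg g) = d.
have rk_ex n : exists d, rk n d.
  by have [g _ gE] := homs_iter n fm; exists (\dim (limg g)), g.
have ex_q : exists d, `[< exists n, rk n d >].
  by have [d h] := rk_ex 0%N; exists d; apply/asboolP; exists 0%N.
case: (ex_minnP ex_q) => d /asboolP[N [g gE dg]] dmin.
have gm : g \in homs X X.
  have [g' gm' gE'] := homs_iter N fm; suff -> : g = g' by [].
  by apply/lfunP => x; rewrite gE gE'.
have disj : (limg g :&: lker g = 0)%VS.
  apply/eqP; rewrite -dimv_eq0; have := limg_ker_dim g (limg g).
  rewrite -limg_comp => e; rewrite -leqn0 -(leq_add2r (\dim (limg (g \o g)%VF))) e add0n.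
  rewrite dg; apply: dmin; apply/asboolP; exists (N + N)%N; exists (g \o g)%VF => // x.
  by rewrite comp_lfunE !gE iterD.
pose e := daddv_pi (limg g) (lker g).
(* A [g]-stable [S] is the sum of [g @: S] and [S :&: lker g], by rank-nullity on [S]; hence the
   projection [e] preserves the flags. *)
have eS (S : {vspace ospace X}) x : (forall y, y \in S -> g y \in S) -> x \in S -> e x \in S.
  move=> gS xS; have gSS : (g @: S <= S)%VS.
    by apply/subvP => _ /memv_imgP[y yS ->]; apply: gS.
  have : x \in (g @: S + S :&: lker g)%VS.
    suff -> : (g @: S + S :&: lker g)%VS = S by [].
    have disjS : (g @: S :&: (S :&: lker g) = 0)%VS.
      apply/eqP; rewrite -subv0 -disj; apply: capvS; last exact: capvSr.
      exact: limgS (subvf _).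
    apply/eqP; rewrite eqEdim subv_add gSS capvSl /= (dimv_disjoint_sum disjS).
    by rewrite addnC limg_ker_dim.
  case/memv_addP => _ /memv_imgP[y yS ->] [z]; rewrite memv_cap => /andP[zS zk] ->.
  rewrite linearD /= /e daddv_pi_id ?memv_img ?memvf //.
  suff -> : daddv_pi (limg g) (lker g) z = 0 by rewrite addr0 gS.
  have := daddv_pi_add disj (subvP (addvSr (limg g) _) _ zk).
  rewrite [daddv_pi (lker g) _ z]daddv_pi_id 1?capvC //.
  by rewrite -[RHS]add0r => /addIr.
have [gA gB gC] := elimT (homsP g) gm.
have [j jm jE] := homs_vsval (limg g).
have [||||s sm sE] := @morph_ex _ _ _ _ X (subobj (limg g)) (fun x => vsproj (limg g) (e x)).
- by move=> a u v; rewrite !linearP.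
- by move=> i x xA; rewrite mem_subobj vsprojK ?memv_pi //; apply: eS => // y; apply: gA.
- by move=> i x xA; rewrite mem_subobj vsprojK ?memv_pi //; apply: eS => // y; apply: gB.
- by move=> i x xA; rewrite mem_subobj vsprojK ?memv_pi //; apply: eS => // y; apply: gC.
have js : cancel j s.
  by move=> x; rewrite sE jE /e daddv_pi_id ?subvsP // vsvalK.
have [z0|sj] := indecomposable_retraction Xind jm sm js.
  right; exists N => x; rewrite -gE.
  have gx : g x \in limg g by rewrite memv_img ?memvf.
  by rewrite -(vsprojK gx) (z0 (vsproj _ _)) linear0.
(* The least rank is then the full dimension, and the first power [f] has at least that rank. *)
left; have gfull : limg g = fullv.
  by apply/vspaceP => x; rewrite -(sj x) jE subvsP memvf.
have df : (\dim {:ospace X} <= \dim (limg f))%N.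
  by rewrite -[X in (\dim X <= _)%N]gfull dg; apply: dmin; apply/asboolP; exists 1%N; exists f.
have := limg_ker_dim f fullv; rewrite capfv => h.
by rewrite -dimv_eq0 -leqn0 -(leq_add2r (\dim (limg f))) h add0n.
Qed.

(** If [a] is nilpotent, then [b x = 0] gives [a x = x], whence [x = 0]. *)
Lemma indecomposable_local X (a b : 'End(ospace X)) :
  indecomposable X -> a \in homs X X -> (forall x, a x + b x = x) ->
  lker a == 0%VS \/ lker b == 0%VS.
Proof.
move=> Xind am ab; have [?|[N aN]] := indecomposable_endo Xind am; [by left|right].
rewrite -subv0; apply/subvP => x; rewrite memv_ker memv0 => /eqP bx.
have ax : a x = x by have := ab x; rewrite bx addr0.
by rewrite -(aN x); elim: N {aN} => //= N /eqP <-; rewrite ax.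
Qed.

Lemma dimvec_addI (d e e' : triple p q r) : d + e = d + e' -> e = e'.
Proof.
case: d e e' => [[a b] c] [[a1 b1] c1] [[a2 b2] c2].
have I k (x y z : composition k) : x + y = x + z -> y = z.
  by move=> /ffunP h; apply/ffunP => i; have := h i; rewrite !ffunE => /addnI.
by case=> /I-> /I-> /I->.
Qed.

Lemma homs_inl X Y : exists2 f : 'Hom(ospace X, ospace (dsum X Y)),
  f \in homs X (dsum X Y) & f =1 (fun x => (x, 0)).
Proof.
apply: morph_ex => [a u v|i x|i x|i x]; rewrite ?mem_dsum /= ?mem0v ?andbT //.
by congr (_, _); rewrite /= scaler0 addr0.
Qed.

Lemma homs_inr X Y : exists2 f : 'Hom(ospace Y, ospace (dsum X Y)),
  f \in homs Y (dsum X Y) & f =1 (fun y => (0, y)).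
Proof.
apply: morph_ex => [a u v|i x|i x|i x]; rewrite ?mem_dsum /= ?mem0v ?andbT //.
by congr (_, _); rewrite /= scaler0 addr0.
Qed.

Lemma homs_fst X Y : exists2 f : 'Hom(ospace (dsum X Y), ospace X),
  f \in homs (dsum X Y) X & f =1 fst.
Proof. by apply: morph_ex => // i x; rewrite mem_dsum => /andP[]. Qed.

Lemma homs_snd X Y : exists2 f : 'Hom(ospace (dsum X Y), ospace Y),
  f \in homs (dsum X Y) Y & f =1 snd.
Proof. by apply: morph_ex => // i x; rewrite mem_dsum => /andP[]. Qed.

(* As End L is local, the isomorphism can be corrected so that its component
   L -> L is invertible; the Schur complement then maps X to X'. *)
Lemma cancel_indecomposable L X X' :
  indecomposable L -> iso (dsum L X) (dsum L X') -> iso X X'.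
Proof.
move=> Lind LX; have eXX' : dimvec X = dimvec X'.
  by have := iso_dimvec LX; rewrite !dimvec_dsum => /dimvec_addI.
have /isoP[f [g [fm gm gf fg]]] := LX.
have [iL iLm iLE] := homs_inl L X; have [iX iXm iXE] := homs_inr L X.
have [pL pLm pLE] := homs_fst L X'; have [pX pXm pXE] := homs_snd L X'.
have [qL qLm qLE] := homs_fst L X.
have [jL jLm jLE] := homs_inl L X'; have [jX jXm jXE] := homs_inr L X'.
pose a := (pL \o f \o iL)%VF; pose b := (pL \o f \o iX)%VF.
pose c := (pX \o f \o iL)%VF; pose d := (pX \o f \o iX)%VF.
pose a' := (qL \o g \o jL)%VF; pose b' := (qL \o g \o jX)%VF.
have am : a \in homs L L by apply: homs_comp iLm (homs_comp fm pLm).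
have bm : b \in homs X L by apply: homs_comp iXm (homs_comp fm pLm).
have cm : c \in homs L X' by apply: homs_comp iLm (homs_comp fm pXm).
have dm : d \in homs X X' by apply: homs_comp iXm (homs_comp fm pXm).
have am' : a' \in homs L L by apply: homs_comp jLm (homs_comp gm qLm).
have bm' : b' \in homs X' L by apply: homs_comp jXm (homs_comp gm qLm).
have fE l x : f (l, x) = (a l + b x, c l + d x).
  have -> : (l, x) = iL l + iX x :> ospace (dsum L X).
    by rewrite iLE iXE; congr (_, _); rewrite /= ?addr0 ?add0r.
  by rewrite linearD /= [LHS]surjective_pairing /a /b /c /d !comp_lfunE !pLE !pXE.
have gE l x : (g (l, x)).1 = a' l + b' x.
  have -> : (l, x) = jL l + jX x :> ospace (dsum L X').
    by rewrite jLE jXE; congr (_, _); rewrite /= ?addr0 ?add0r.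
  by rewrite linearD /= /a' /b' !comp_lfunE !qLE.
clearbody a b c d a' b'.
have e1 l : (a' \o a)%VF l + (b' \o c)%VF l = l.
  rewrite !comp_lfunE -gE; have := fE l 0; rewrite !linear0 !addr0 => <-.
  by rewrite gf.
have inj_comp (U V W : vectType F) (h : 'Hom(U, V)) (k : 'Hom(V, W)) :
    lker (k \o h)%VF == 0%VS -> lker h == 0%VS.
  move=> /lker0P kh; apply/lker0P => x y xy; apply: kh; by rewrite !comp_lfunE xy.
(* If [a] is not injective, then by [e1] and locality [w = b' c] is invertible, with inverse [v]. As
   [v (a + w) - v a = 1] and [v a] is not injective, [a + w] is injective, so [u = b'] works. *)
have [u um su] : exists2 u, u \in homs X' L & lker (a + (u \o c)%VF)%R == 0%VS.
  have [a0|an0] := boolP (lker a == 0%VS).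
    by exists 0; rewrite ?mem0v // comp_lfun0l addr0.
  exists b' => //.
  have wm : (b' \o c)%VF \in homs L L by apply: homs_comp cm bm'.
  have [/inj_comp a0|w0] := indecomposable_local Lind (homs_comp am am') e1.
    by rewrite a0 in an0.
  have [v vm vw] : exists2 v : 'End(ospace L), v \in homs L L & cancel (b' \o c)%VF v.
    by have [vm vw _] := homs_inv wm w0 erefl; exists ((b' \o c)^-1)%VF.
  move: (b' \o c)%VF wm vw {w0 e1} => w wm vw.
  have [|x||] := @indecomposable_local L (v \o (a + w))%VF (- (v \o a))%VF Lind.
  - by apply: (homs_comp _ vm); rewrite memvD.
  - by rewrite opp_lfunE !comp_lfunE add_lfunE linearD /= addrC addKr; apply: vw.
  - by move/inj_comp.
  - move=> h; case/negP: an0; apply/(inj_comp _ _ _ _ (- v)%R).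
    by rewrite comp_lfunNl.
pose s := a + (u \o c)%VF.
have sm : s \in homs L L by rewrite memvD // (homs_comp cm um).
have [vm sv vs] := homs_inv sm su erefl.
(* Adding [u] times the second row to the first turns [(a, b)] into [(s, b + u d)]; [D] is the Schur
   complement of [s]. A kernel vector [x] of [D] yields the kernel vector [(l, x)] of [f]. *)
pose D := d - (c \o s^-1 \o (b + (u \o d)%VF))%VF.
apply: (@iso_bij _ _ _ _ _ _ D) => //.
  rewrite memvB //; apply: (homs_comp _ (homs_comp vm cm)).
  by rewrite memvD // (homs_comp dm um).
rewrite -subv0; apply/subvP => x; rewrite memv_ker memv0 => /eqP Dx.
pose l := - s^-1%VF ((b + (u \o d)%VF) x).
have h1 : c l + d x = 0.
  by move: Dx; rewrite add_lfunE opp_lfunE !comp_lfunE /l linearN /= addrC.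
have h2 : a l + b x = 0.
  have : s l + (b x + u (d x)) = 0.
    by rewrite /l linearN /= vs add_lfunE comp_lfunE addNr.
  rewrite /s add_lfunE comp_lfunE addrACA -linearD /= h1 linear0 addr0 //.
have : (l, x) = 0 :> ospace (dsum L X).
  by apply: (can_inj gf); rewrite fE h1 h2 linear0.
by case=> _ ->.
Qed.

(** * Retracts, decompositions and cancellation *)

Definition retract L X := exists (j : 'Hom(ospace L, ospace X)) (s : 'Hom(ospace X, ospace L)),
  [/\ j \in homs L X, s \in homs X L & cancel j s].

Lemma retract_iso L X Y : retract L X -> iso X Y -> retract L Y.
Proof.
move=> [j [s [jm sm js]]] /isoP[f [g [fm gm gf _]]].
exists (f \o j)%VF, (s \o g)%VF; split; [exact: homs_comp jm fm|exact: homs_comp gm sm|].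
by move=> x; rewrite !comp_lfunE gf js.
Qed.

Lemma retract_dsuml X Y : retract X (dsum X Y).
Proof.
have [i im iE] := homs_inl X Y; have [s sm sE] := homs_fst X Y.
by exists i, s; split=> // x; rewrite sE iE.
Qed.

Lemma retract_split L X : retract L X -> exists Y, iso X (dsum L Y).
Proof.
by move=> [j [s [jm sm js]]]; exists (subobj (lker s)); apply: split_retraction js.
Qed.

Lemma indecomposable_neq0 X : indecomposable X -> (0 < \dim {:ospace X})%N.
Proof. by case=> h _; rewrite lt0n; apply/eqP => /iso_zero. Qed.

Lemma retract_indecomposable L X :
  retract L X -> indecomposable X -> (0 < \dim {:ospace L})%N -> iso L X.
Proof.
move=> [j [s [jm sm js]]] Xind L0.
have [z0|sj] := indecomposable_retraction Xind jm sm js.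
  by move: L0; have /iso_zeroP/iso_zero-> := z0.
by apply/isoP; exists j, s.
Qed.

(** The identity of [L] is the sum of its parts through [Y] and through [Z]; by locality one of them
    is invertible. *)
Lemma retract_dsum L Y Z : indecomposable L -> retract L (dsum Y Z) ->
  retract L Y \/ retract L Z.
Proof.
move=> Lind [j [s [jm sm js]]].
have [iY iYm iYE] := homs_inl Y Z; have [iZ iZm iZE] := homs_inr Y Z.
have [pY pYm pYE] := homs_fst Y Z; have [pZ pZm pZE] := homs_snd Y Z.
have aux K (i : 'Hom(ospace K, ospace (dsum Y Z))) (t : 'Hom(ospace (dsum Y Z), ospace K)) :
    i \in homs K (dsum Y Z) -> t \in homs (dsum Y Z) K ->
    lker ((s \o i) \o (t \o j))%VF == 0%VS -> retract L K.
  move=> im tm h; have tj := homs_comp jm tm; have si := homs_comp im sm.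
  have [vm vw _] := homs_inv (homs_comp tj si) h erefl.
  exists (t \o j)%VF, (((s \o i) \o (t \o j))^-1 \o (s \o i))%VF; split=> //.
    exact: homs_comp si vm.
  by move=> x; rewrite [LHS]comp_lfunE -(comp_lfunE (s \o i)%VF) vw.
have m1 : ((s \o iY) \o (pY \o j))%VF \in homs L L.
  exact: homs_comp (homs_comp jm pYm) (homs_comp iYm sm).
have [|h|h] := indecomposable_local (b := ((s \o iZ) \o (pZ \o j))%VF) Lind m1.
- move=> x; rewrite !comp_lfunE -linearD -[RHS]js; congr (s _).
  rewrite iYE iZE pYE pZE [RHS]surjective_pairing; congr (_, _).
    by rewrite /= addr0.
  by rewrite /= add0r.
- by left; apply: aux h.
- by right; apply: aux h.
Qed.

Lemma decomposable X : ~ iso X (zero_obj F p q r) -> ~ indecomposable X ->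
  exists Y Z, [/\ iso X (dsum Y Z), (0 < \dim {:ospace Y})%N & (0 < \dim {:ospace Z})%N].
Proof.
move=> X0 Xdec; apply: contrapT => h; apply: Xdec; split=> // Y Z XYZ.
apply: contrapT => /not_orP[Y0 Z0]; apply: h; exists Y, Z; split=> //.
  by rewrite lt0n; apply/eqP => /iso_zero.
by rewrite lt0n; apply/eqP => /iso_zero.
Qed.

(** By induction on the dimension: when [X] splits, one of the two components of [h] is nonzero.
    Only linearity of [h] matters, so [T] is a bare vector space. *)
Lemma indecomposable_summand X (T : vectType F) (h : 'Hom(T, ospace X)) : h != 0 ->
  exists L (j : 'Hom(ospace L, ospace X)) (s : 'Hom(ospace X, ospace L)),
  [/\ indecomposable L, j \in homs L X, s \in homs X L, cancel j s & (s \o h)%VF != 0].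
Proof.
have [n] := ubnP (\dim {:ospace X}); elim: n => // n IH in X h *; rewrite ltnS => dX h0.
have [Xind|Xdec] := pselect (indecomposable X).
  exists X, \1%VF, \1%VF; rewrite comp_lfun1l homs_id; split=> // x.
  by rewrite !id_lfunE.
have X0 : ~ iso X (zero_obj F p q r).
  by move/iso_zeroP => x0; case/eqP: h0; apply/lfunP => x; rewrite [LHS]x0 [RHS]x0.
have [Y [Z [/isoP[f [g [fm gm gf fg]]] Y0 Z0]]] := decomposable X0 Xdec.
have XYZ : iso X (dsum Y Z) by apply/isoP; exists f, g.
have dYZ : \dim {:ospace X} = (\dim {:ospace Y} + \dim {:ospace Z})%N.
  by rewrite (iso_dim XYZ) dim_dsum.
have aux K (i : 'Hom(ospace K, ospace (dsum Y Z))) (t : 'Hom(ospace (dsum Y Z), ospace K)) :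
    i \in homs K (dsum Y Z) -> t \in homs (dsum Y Z) K -> cancel i t ->
    (\dim {:ospace K} < n)%N -> (t \o f \o h)%VF != 0 ->
  exists L (j : 'Hom(ospace L, ospace X)) (s : 'Hom(ospace X, ospace L)),
  [/\ indecomposable L, j \in homs L X, s \in homs X L, cancel j s & (s \o h)%VF != 0].
  move=> im tm it dK th0; have [L [j [s [Lind jm sm js sh]]]] := IH _ _ dK th0.
  exists L, (g \o i \o j)%VF, (s \o t \o f)%VF; split=> //.
  - exact: homs_comp jm (homs_comp im gm).
  - exact: homs_comp fm (homs_comp tm sm).
  - by move=> x; rewrite !comp_lfunE fg it js.
  - by rewrite -!comp_lfunA in sh *.
have [iY iYm iYE] := homs_inl Y Z; have [iZ iZm iZE] := homs_inr Y Z.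
have [pY pYm pYE] := homs_fst Y Z; have [pZ pZm pZE] := homs_snd Y Z.
have [th|th] := eqVneq (pY \o f \o h)%VF 0; last first.
  by apply: aux iYm pYm _ _ th; [move=> x; rewrite pYE iYE | lia].
have [th'|th'] := eqVneq (pZ \o f \o h)%VF 0; last first.
  by apply: aux iZm pZm _ _ th'; [move=> x; rewrite pZE iZE | lia].
case/eqP: h0; apply/lfunP => x; apply: (can_inj gf); rewrite zero_lfunE linear0.
have /lfunP/(_ x) := th; have /lfunP/(_ x) := th'; rewrite !comp_lfunE pYE pZE !zero_lfunE.
by case: (f _) => y z /= -> ->.
Qed.

Fixpoint dsums (s : seq obj) : obj :=
  if s is X :: s' then dsum X (dsums s') else zero_obj F p q r.

Lemma dsums_cat s1 s2 : iso (dsums (s1 ++ s2)) (dsum (dsums s1) (dsums s2)).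
Proof.
elim: s1 => [|X s1 IH] /=; first by apply/iso_sym/dsum_zerol/iso_refl.
exact: iso_trans (dsum_iso (iso_refl X) IH) (dsum_assoc _ _ _).
Qed.

Lemma decomposition X : exists2 s : seq obj,
  List.Forall (@indecomposable F p q r) s & iso X (dsums s).
Proof.
have [n] := ubnP (\dim {:ospace X}); elim: n => // n IH in X *; rewrite ltnS => dX.
have [X0|X0] := pselect (iso X (zero_obj F p q r)); first by exists [::].
have [Xind|Xdec] := pselect (indecomposable X).
  exists [:: X]; first by constructor.
  apply/iso_sym/(iso_trans (dsum_comm _ _))/dsum_zerol/iso_refl.
have [Y [Z [XYZ Y0 Z0]]] := decomposable X0 Xdec.
have := iso_dim XYZ; rewrite dim_dsum => dYZ.
have [|s hs Ys] := IH Y; first by lia.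
have [|t ht Zt] := IH Z; first by lia.
exists (s ++ t); first by apply/List.Forall_app.
apply: iso_trans XYZ (iso_trans (dsum_iso Ys Zt) (iso_sym (dsums_cat _ _))).
Qed.

(** [Y] is decomposed and its indecomposable summands are cancelled one at a time. *)
Lemma dsum_cancel Y X X' : iso (dsum Y X) (dsum Y X') -> iso X X'.
Proof.
have [s hs Ys] := decomposition Y; move=> h.
have {h} : iso (dsum (dsums s) X) (dsum (dsums s) X').
  apply: iso_trans (dsum_iso (iso_sym Ys) (iso_refl X)) _.
  exact: iso_trans h (dsum_iso Ys (iso_refl _)).
elim: hs X X' {Ys} => /= [|L {}s Lind hs IH] X X' h.
  apply: iso_trans (iso_sym (dsum_zerol X (iso_refl _))) _.
  exact: iso_trans h (dsum_zerol _ (iso_refl _)).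
apply: IH; apply: (cancel_indecomposable Lind).
exact: iso_trans (dsum_assoc _ _ _) (iso_trans h (iso_sym (dsum_assoc _ _ _))).
Qed.

End Decomposition.

(** * Orbits and finite type *)

Section Transport.
Variables (F : fieldType) (p q r : nat).
Local Notation obj := (obj F p q r).
Implicit Types (X Y Z L K : obj) (d e : triple p q r).

Lemma obj_ex e : Lambda e -> exists X, dimvec X = e.
Proof.
case: e => [[a b] c] [/= ab bc]; pose V : vectType F := 'rV[F]_(csize a).
have dV : \dim {:V} = csize a by rewrite dimvf /dim /= mul1n.
have [A <-] := flag_ex dV; have [B <-] := flag_ex (etrans dV ab).
have [C <-] := flag_ex (etrans dV (etrans ab bc)).
by exists (Obj A B C).
Qed.

Lemma imflag_ex (V W : vectType F) k (g : 'Hom(V, W)) (A : flag V k) :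
  lker g == 0%VS -> limg g = fullv ->
  exists A' : flag W k, forall i, A' i = (g @: A i)%VS.
Proof.
move=> g0 gW; have [|||A' A'E] := @flag_of_steps F W k (fun i => g @: step A i)%VS.
- by rewrite step0 limg0.
- by rewrite step_max.
- by move=> j jk; apply: limgS; apply: stepS.
by exists A' => i; rewrite A'E stepE.
Qed.

Lemma image_obj_ex X (W : vectType F) (ga gb gc : 'Hom(ospace X, W)) :
  \dim {:W} = \dim {:ospace X} ->
  lker ga == 0%VS -> lker gb == 0%VS -> lker gc == 0%VS ->
  exists (A : flag W p) (B : flag W q) (C : flag W r),
  [/\ forall i, A i = (ga @: flagA X i)%VS, forall i, B i = (gb @: flagB X i)%VS
    & forall i, C i = (gc @: flagC X i)%VS].
Proof.
move=> dW a0 b0 c0.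
have full (g : 'Hom(ospace X, W)) : lker g == 0%VS -> limg g = fullv.
  by move=> /eqP g0; apply/eqP; rewrite eqEdim subvf limg_dim_eq ?g0 ?capv0 // dW leqnn.
have [A AE] := imflag_ex (flagA X) a0 (full _ a0).
have [B BE] := imflag_ex (flagB X) b0 (full _ b0).
by have [C CE] := imflag_ex (flagC X) c0 (full _ c0); exists A, B, C.
Qed.

Lemma iso_image X (W : vectType F) (g : 'Hom(ospace X, W)) (A : flag W p)
    (B : flag W q) (C : flag W r) :
  \dim {:W} = \dim {:ospace X} -> lker g == 0%VS ->
  (forall i, A i = (g @: flagA X i)%VS) -> (forall i, B i = (g @: flagB X i)%VS) ->
  (forall i, C i = (g @: flagC X i)%VS) -> iso X (Obj A B C).
Proof.
move=> dW g0 AE BE CE.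
have dg (U : {vspace ospace X}) : \dim (g @: U) = \dim U.
  by rewrite limg_dim_eq ?(eqP g0) ?capv0.
apply: (@iso_bij _ _ _ _ X (Obj A B C) g) => //.
  by apply/homsP; split=> i x xi; rewrite /= ?AE ?BE ?CE memv_img.
by rewrite /dimvec; congr (_, _, _); apply: eq_flag_type => i; rewrite /= ?AE ?BE ?CE dg.
Qed.

(** Each isomorphism class is realised on the given space [V], by transport along a linear
    isomorphism. *)
Lemma Fl3_ex X (V : vectType F) d : dimvec X = d -> \dim {:V} = \dim {:ospace X} ->
  exists Y : Fl3 V d, iso X (obj_of Y).
Proof.
move=> <- dV; have [g gV] := lfun_onto (esym dV).
have g0 : lker g == 0%VS.
  have := limg_ker_dim g fullv; rewrite capfv gV dV -[X in _ = X -> _]add0n => /addIn/eqP.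
  by rewrite dimv_eq0.
have [A [B [C [AE BE CE]]]] := image_obj_ex dV g0 g0 g0.
have XY := iso_image dV g0 AE BE CE.
have [eA eB eC] := iso_dims XY.
exists ((exist _ A (esym (eq_flag_type eA)) : Fl V (dimvec X).1.1,
         exist _ B (esym (eq_flag_type eB)) : Fl V (dimvec X).1.2),
        exist _ C (esym (eq_flag_type eC)) : Fl V (dimvec X).2).
exact: XY.
Qed.

Lemma dimvec_obj_of (V : vectType F) d (X : Fl3 V d) : dimvec (obj_of X) = d.
Proof.
by case: d X => [[a b] c] [[[A eA] [B eB]] [C eC]]; rewrite /dimvec /= eA eB eC.
Qed.

Lemma orbit3P (V : vectType F) d (X Y : Fl3 V d) :
  orbit3 X Y <-> iso (obj_of X) (obj_of Y).
Proof.
split=> [[g [gbij [/ffunP hA /ffunP hB /ffunP hC]]]|].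
  apply: (@iso_bij _ _ _ _ (obj_of X) (obj_of Y) g); last by rewrite !dimvec_obj_of.
    by apply/homsP; split=> i x xi;
      [have := hA i|have := hB i|have := hC i]; rewrite ffunE => <-; apply: memv_img.
  by apply/lker0P; apply: bij_inj.
move=> XY; have [eA eB eC] := iso_dims XY.
move/isoP: XY => [f [g [/homsP[fA fB fC] _ fg gf]]]; exists f; split; first by exists g.
have f0 : lker f == 0%VS by apply: lker0_cancel fg.
have im (U U' : {vspace V}) : (forall x, x \in U -> f x \in U') -> \dim U = \dim U' ->
    (f @: U)%VS = U'.
  move=> fU dU; apply/eqP; rewrite eqEdim -dU limg_dim_eq ?(eqP f0) ?capv0 // leqnn andbT.
  by apply/subvP => _ /memv_imgP[y yU ->]; apply: fU.
by split; apply/ffunP => i; rewrite ffunE; apply: im;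
  [apply: fA|apply: eA|apply: fB|apply: eB|apply: fC|apply: eC].
Qed.

Lemma orbit3E (V : vectType F) d (X : Fl3 V d) :
  orbit3 X = [set Y | iso (obj_of X) (obj_of Y)]%classic.
Proof. by apply/seteqP; split=> Y; rewrite -[X in _ -> X]/(_) /= => /orbit3P. Qed.

(** Finite type stated without a fixed space [V]: finitely many isomorphism classes of objects. *)
Definition fin_reps d := exists m (T : nat -> obj),
  forall X, dimvec X = d -> exists2 k, (k < m)%N & iso X (T k).

Lemma finite_typeP d : finite_type F d <-> fin_reps d.
Proof.
split=> [fd|[m [T hT]] V dV]; last first.
  apply: (@sub_finite_set _ _ ((fun k => [set Y | iso (T k) (obj_of Y)]) @` `I_m)%classic).
    move=> _ [X _ <-]; have [k km Xk] := hT (obj_of X) (dimvec_obj_of X).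
    exists k => //; rewrite orbit3E; apply/seteqP; split=> Y /=.
      exact: iso_trans.
    exact: iso_trans (iso_sym Xk).
  exact/finite_image/finite_II.
have [[T0 dT0]|none] := pselect (exists T0 : obj, dimvec T0 = d); last first.
  exists 0%N, (fun=> zero_obj F p q r) => X dX; by case: none; exists X.
have dV : \dim {:ospace T0} = csize d.1.1.
  by rewrite -(csize_flag_type (flagA T0)) -dT0.
have /finite_setP[m /card_esym/card_set_bijP[f [_ _ fsurj]]] := fd (ospace T0) dV.
(* A representative for each number [k] of an orbit; [T0] is the default when [k] numbers none. *)
have /choice[T TP] : forall k, exists Tk : obj, forall Y : Fl3 (ospace T0) d,
    f k = orbit3 Y -> iso (obj_of Y) Tk.
  move=> k.
  have [[Y fY]|no] := pselect (exists Y : Fl3 (ospace T0) d, f k = orbit3 Y).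
    exists (obj_of Y) => Y'; rewrite fY => YY'; apply/iso_sym/orbit3P.
    by rewrite YY'; apply/orbit3P/iso_refl.
  by exists T0 => Y fY; case: no; exists Y.
exists m, T => X dX.
have dXT : \dim {:ospace T0} = \dim {:ospace X}.
  by rewrite -(csize_flag_type (flagA X)) dV -dX.
have [Y XY] := Fl3_ex dX dXT.
have [k km fk] := fsurj (orbit3 Y) (ex_intro2 _ _ Y I erefl).
by exists k => //; apply: iso_trans XY _; apply: TP.
Qed.

(** For a fixed [Y0] of dimension vector [e], adding [Y0] is injective on isomorphism classes by
    cancellation. *)
Lemma fin_reps_sub d e : Lambda e -> fin_reps (e + d) -> fin_reps d.
Proof.
move=> /obj_ex[Y0 <-] [m [T hT]].
have /choice[T' T'P] : forall k, exists Tk : obj, forall X,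
    iso (dsum Y0 X) (T k) -> iso X Tk.
  move=> k.
  have [[X' X'k]|no] := pselect (exists X, iso (dsum Y0 X) (T k)).
    exists X' => X Xk; apply: (@dsum_cancel _ _ _ _ Y0).
    exact: iso_trans Xk (iso_sym X'k).
  by exists Y0 => X Xk; case: no; exists X.
exists m, T' => X dX; have [|k km Xk] := hT (dsum Y0 X); first by rewrite dimvec_dsum dX.
by exists k => //; apply: T'P.
Qed.

End Transport.

(** * Euler form and rigidity *)

Section Defect.
Variables (F : fieldType) (p q r : nat).
Local Notation obj := (obj F p q r).
Implicit Types (X Y Z L K : obj) (d e : triple p q r).

Definition hdim X Y : nat := \dim (homs X Y).

Lemma dim_le_inj (U V : vectType F) (S : {vspace U}) (T : {vspace V}) (M : 'Hom(U, V)) :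
  (forall x, x \in S -> M x \in T) -> (forall x, M x = 0 -> x = 0) -> (\dim S <= \dim T)%N.
Proof.
move=> ST M0; rewrite -(@limg_dim_eq _ _ _ M).
  by apply: dimvS; apply/subvP => _ /memv_imgP[x xS ->]; apply: ST.
apply/eqP; rewrite -subv0; apply/subvP => x; rewrite memv_cap memv_ker memv0.
by case/andP=> _ /eqP/M0->.
Qed.

Lemma hom_isol X Y Z : iso X Y -> hdim X Z = hdim Y Z.
Proof.
suff le X' Y' : iso X' Y' -> (hdim X' Z <= hdim Y' Z)%N.
  by move=> XY; apply/eqP; rewrite eqn_leq !le //; apply: iso_sym.
move=> /isoP[f [g [_ gm gf _]]].
have [|M ME] := @lfun_of_linear _ _ _ (fun h : 'Hom(ospace X', ospace Z) => (h \o g)%VF).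
  by move=> a u v; rewrite comp_lfunDl comp_lfunZl.
apply: (@dim_le_inj _ _ _ _ M) => [h hm|h]; rewrite ME; first exact: homs_comp gm hm.
by move/lfunP=> hg; apply/lfunP => x; have := hg (f x); rewrite comp_lfunE gf !zero_lfunE.
Qed.

Lemma hom_isor X Y Z : iso Y Z -> hdim X Y = hdim X Z.
Proof.
suff le Y' Z' : iso Y' Z' -> (hdim X Y' <= hdim X Z')%N.
  by move=> YZ; apply/eqP; rewrite eqn_leq !le //; apply: iso_sym.
move=> /isoP[f [g [fm _ gf _]]].
have [|M ME] := @lfun_of_linear _ _ _ (fun h : 'Hom(ospace X, ospace Y') => (f \o h)%VF).
  by move=> a u v; rewrite comp_lfunDr comp_lfunZr.
apply: (@dim_le_inj _ _ _ _ M) => [h hm|h]; rewrite ME; first exact: homs_comp hm fm.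
move/lfunP=> hf; apply/lfunP => x; have := hf x; rewrite comp_lfunE !zero_lfunE.
by move=> e; rewrite -(gf (h x)) e linear0.
Qed.

(** A projection with kernel [S]; its image stands for the quotient by [S], and membership in [S]
    becomes a linear equation. *)
Definition resid (V : vectType F) (S : {vspace V}) : 'End(V) := \1%VF - projv S.

Lemma resid_eq0 (V : vectType F) (S : {vspace V}) v : (resid S v == 0) = (v \in S).
Proof.
rewrite /resid add_lfunE opp_lfunE id_lfunE subr_eq0.
by apply/eqP/idP => [->|/projv_id//]; apply: memv_proj.
Qed.

Definition ends X : vectType F :=
  ('End(ospace X) * 'End(ospace X) * 'End(ospace X))%type.
Definition maps X Y : vectType F :=
  ('Hom(ospace X, ospace Y) * 'Hom(ospace X, ospace Y) * 'Hom(ospace X, ospace Y))%type.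

(** The class of a triple of maps modulo filtered maps. Sending [f] to the class of [(f, f, f)] has
    kernel Hom(X, Y) and, inside the image of [resid3], cokernel Ext^1(X, Y). *)
Definition resid3 X Y (h : maps X Y) : maps X Y :=
  (resid (fhom (flagA X) (flagA Y)) h.1.1,
   resid (fhom (flagB X) (flagB Y)) h.1.2, resid (fhom (flagC X) (flagC Y)) h.2).

Lemma resid3_linear X Y : linear (@resid3 X Y).
Proof.
move=> a u v; rewrite /resid3; move: (resid _) (resid _) (resid _) => f1 f2 f3.
by congr (_, _, _); exact: linearP.
Qed.

Lemma resid3_eq0 X Y (h : maps X Y) :
  resid3 h = 0 <-> [/\ h.1.1 \in fhom (flagA X) (flagA Y),
    h.1.2 \in fhom (flagB X) (flagB Y) & h.2 \in fhom (flagC X) (flagC Y)].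
Proof.
split=> [[eA eB eC]|[]]; first by split; rewrite -resid_eq0; apply/eqP.
rewrite -resid_eq0 => /eqP eA; rewrite -resid_eq0 => /eqP eB.
rewrite -resid_eq0 => /eqP eC; exact: (congr2 pair (congr2 pair eA eB) eC).
Qed.

(* The kernel of defect Y g is Hom(gX, Y), where gX is X with its three flags
   moved by the three components of g. *)
Lemma defect_ex X Y (g : ends X) : exists M : 'Hom('Hom(ospace X, ospace Y), maps X Y),
  forall f, M f = resid3 ((f \o g.1.1)%VF, (f \o g.1.2)%VF, (f \o g.2)%VF).
Proof.
apply: lfun_of_linear => a u v; rewrite -resid3_linear; congr (resid3 (_, _, _)).
- by rewrite comp_lfunDl -comp_lfunZl.
- by rewrite comp_lfunDl -comp_lfunZl.
- by rewrite comp_lfunDl -comp_lfunZl.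
Qed.

Definition defect X Y g := projT1 (cid (@defect_ex X Y g)).

Lemma defectE X Y g f :
  defect Y g f = @resid3 X Y ((f \o g.1.1)%VF, (f \o g.1.2)%VF, (f \o g.2)%VF).
Proof. exact: projT2 (cid (@defect_ex X Y g)) f. Qed.

(** Linearity in the moving triple turns a line of triples into a pencil of linear maps. *)
Lemma defect_linear X Y t (g h : ends X) :
  defect Y (g + t *: h) = defect Y g + t *: defect Y h.
Proof.
apply/lfunP => f; rewrite add_lfunE scale_lfunE !defectE addrC [RHS]addrC -resid3_linear.
congr (resid3 (_, _, _)).
- by rewrite comp_lfunDr -comp_lfunZr addrC.
- by rewrite comp_lfunDr -comp_lfunZr addrC.
- by rewrite comp_lfunDr -comp_lfunZr addrC.
Qed.

Definition id3 X : ends X := (\1%VF, \1%VF, \1%VF).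

Lemma lker_defect_one X Y : lker (defect Y (id3 X)) = homs X Y.
Proof.
apply/vspaceP => f; rewrite memv_ker defectE !comp_lfun1r.
by apply/eqP/idP => [/resid3_eq0[a b c]|]; rewrite !memv_cap; [apply/and3P|move=> /and3P h; apply/resid3_eq0].
Qed.

Lemma resid3_ex X Y : exists M : 'End(maps X Y), forall h, M h = resid3 h.
Proof. exact/lfun_of_linear/resid3_linear. Qed.

Definition lresid3 X Y := projT1 (cid (resid3_ex X Y)).

Lemma lresid3E X Y h : lresid3 X Y h = resid3 h.
Proof. exact: projT2 (cid (resid3_ex X Y)) h. Qed.

Lemma resid3B X Y (h k : maps X Y) : resid3 (h - k) = resid3 h - resid3 k.
Proof. by rewrite -!lresid3E linearB. Qed.

Lemma limg_defect X Y g : (limg (@defect X Y g) <= limg (lresid3 X Y))%VS.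
Proof.
apply/subvP => _ /memv_imgP[f _ ->]; by rewrite defectE -lresid3E; apply: memv_img; apply: memvf.
Qed.

Lemma lker_lresid3 X Y : lker (lresid3 X Y) =
  vsum (vsum (fhom (flagA X) (flagA Y)) (fhom (flagB X) (flagB Y)))
       (fhom (flagC X) (flagC Y)).
Proof.
apply/vspaceP => h; rewrite memv_ker lresid3E !mem_vsum.
apply/eqP/idP => [/resid3_eq0[-> -> ->] //|/andP[/andP[? ?] ?]]; exact/resid3_eq0.
Qed.

(* Vanishing of Ext^1(X, X). *)
Definition rigid X := forall h : ends X, exists f : 'End(ospace X),
  resid3 (h - (f, f, f) : maps X X) = 0.

Lemma rigidE X : rigid X <-> (limg (lresid3 X X) <= limg (defect X (id3 X)))%VS.
Proof.
split=> [Xr|sub h].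
  apply/subvP => _ /memv_imgP[h _ ->]; have [f hf] := Xr h.
  apply/memv_imgP; exists f; rewrite ?memvf // defectE !comp_lfun1r lresid3E.
  by move/eqP: hf; rewrite resid3B subr_eq0 => /eqP.
have : lresid3 X X h \in limg (defect X (id3 X)).
  by apply: subvP sub _ _; rewrite memv_img // memvf.
case/memv_imgP => f _; rewrite defectE !comp_lfun1r lresid3E => e; exists f.
by rewrite resid3B e subrr.
Qed.

(** On [Lambda] this is 2Q + n^2, an expression free of subtraction. *)
Definition sqnorms (d : triple p q r) : nat :=
  (csqnorm d.1.1 + csqnorm d.1.2 + csqnorm d.2)%N.

Lemma dim_limg_lresid3 X :
  (2 * \dim (limg (lresid3 X X)) + sqnorms (dimvec X) = 3 * \dim {:ospace X} ^ 2)%N.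
Proof.
have := limg_ker_dim (lresid3 X X) fullv; rewrite capfv lker_lresid3 !dim_vsum.
have -> : \dim {:maps X X} = (3 * \dim {:ospace X} ^ 2)%N.
  rewrite !dimvf -mulnn; set n := dim (ospace X).
  by rewrite -[LHS]/(n * n + n * n + n * n)%N; ring.
have := dim_fhom_self (flagA X); have := dim_fhom_self (flagB X).
have := dim_fhom_self (flagC X).
rewrite /sqnorms /dimvec /=; move: (\dim {:ospace X} ^ 2)%N => n2.
suff arith a b c l a' b' c' : (2 * c = n2 + c' -> 2 * b = n2 + b' -> 2 * a = n2 + a' ->
    a + b + c + l = 3 * n2 -> 2 * l + (a' + b' + c') = 3 * n2)%N by apply: arith.
lia.
Qed.

Lemma hom_defect X : (hdim X X + \dim (limg (defect X (id3 X))) = \dim {:ospace X} ^ 2)%N.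
Proof.
have := limg_ker_dim (defect X (id3 X)) fullv; rewrite capfv lker_defect_one => ->.
by rewrite !dimvf -mulnn.
Qed.

(** The inequality Q <= dim End X: the image of the defect map lies in that of [lresid3], whose
    dimension comes from the three parabolic subalgebras. *)
Lemma sqnorms_le X : (sqnorms (dimvec X) <= 2 * hdim X X + \dim {:ospace X} ^ 2)%N.
Proof.
have := dim_limg_lresid3 X; have := hom_defect X; have := dimvS (limg_defect X (id3 X)).
move: (\dim {:ospace X} ^ 2)%N (hdim _ _) (sqnorms _) => n2 a b.
by move: (\dim (limg _)) (\dim (limg _)) => l l'; lia.
Qed.

(** The equality case: the inclusion of images is an equality exactly when the dimensions agree. *)
Lemma rigid_hom X : rigid X <->
  (sqnorms (dimvec X) = 2 * hdim X X + \dim {:ospace X} ^ 2)%N.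
Proof.
have e1 := dim_limg_lresid3 X; have e2 := hom_defect X.
have sub := limg_defect X (id3 X); rewrite rigidE -(dimv_leqif_sup sub) //.
move: (\dim {:ospace X} ^ 2)%N (hdim _ _) (sqnorms _) e1 e2 (dimvS sub) => n2 a b.
move: (\dim (limg _)) (\dim (limg _)) => l l' e1 e2 le.
by split=> [/eqP|]; [lia|move=> e; apply/eqP; lia].
Qed.

Lemma rigid_iso X Y : iso X Y -> rigid X -> rigid Y.
Proof.
move=> XY /rigid_hom e; apply/rigid_hom.
by rewrite -(iso_dimvec XY) -(iso_dim XY) -(hom_isol Y XY) -(hom_isor X XY).
Qed.

(** * Moving the three flags independently *)

Definition inj3 X (g : ends X) := [&& lker g.1.1 == 0%VS, lker g.1.2 == 0%VS & lker g.2 == 0%VS].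

Lemma imflag_total (V : vectType F) k (g : 'End(V)) (A : flag V k) :
  exists A' : flag V k, lker g == 0%VS -> forall i, A' i = (g @: A i)%VS.
Proof.
have [g0|_] := boolP (lker g == 0%VS); last by exists A.
by have [A' A'E] := imflag_ex A g0 (lker0_limgf g0); exists A'.
Qed.

(* Junk value A when g is not injective. *)
Definition imflag (V : vectType F) k (g : 'End(V)) (A : flag V k) : flag V k :=
  projT1 (cid (imflag_total g A)).

Lemma imflagE (V : vectType F) k (g : 'End(V)) (A : flag V k) i :
  lker g == 0%VS -> imflag g A i = (g @: A i)%VS.
Proof. by move=> g0; apply: (projT2 (cid (imflag_total g A))). Qed.

Lemma imflag_comp (V : vectType F) k (g h : 'End(V)) (A : flag V k) :
  lker g == 0%VS -> lker h == 0%VS -> imflag h (imflag g A) = imflag (h \o g)%VF A.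
Proof.
move=> g0 h0; apply/flag_inj/ffunP => i; have hg0 : lker (h \o g)%VF == 0%VS.
  move: g0 h0 => /lker0P u0 /lker0P v0; apply/lker0P => x y.
  by rewrite !comp_lfunE => /v0/u0.
by rewrite (imflagE _ _ hg0) (imflagE _ _ h0) (imflagE _ _ g0) limg_comp.
Qed.

Definition moved X (g : ends X) : obj :=
  Obj (imflag g.1.1 (flagA X)) (imflag g.1.2 (flagB X)) (imflag g.2 (flagC X)).

Lemma dimvec_moved X (g : ends X) : inj3 g -> dimvec (moved g) = dimvec X.
Proof.
case/and3P=> a b c; rewrite /dimvec; congr (_, _, _); apply: eq_flag_type => i;
  by rewrite /= imflagE // limg_dim_eq ?(eqP a) ?(eqP b) ?(eqP c) ?capv0.
Qed.

Lemma lker_defect X Y (g : ends X) : inj3 g -> lker (defect Y g) = homs (moved g) Y.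
Proof.
case/and3P=> a b c; apply/vspaceP => f; rewrite memv_ker defectE.
have im k (h : 'End(ospace X)) (A : flag (ospace X) k) (B : flag (ospace Y) k) :
    lker h == 0%VS -> (f \o h)%VF \in fhom A B <-> f \in fhom (imflag h A) B.
  move=> h0; split=> /fhomP fh; apply/fhomP => i x.
    by rewrite imflagE // => /memv_imgP[y yA ->]; rewrite -comp_lfunE; apply: fh.
  by move=> xA; rewrite comp_lfunE; apply: fh; rewrite imflagE // memv_img.
apply/eqP/idP => [/resid3_eq0[/im hA /im hB /im hC]|].
  by rewrite !memv_cap /= hA // hB // hC.
by rewrite !memv_cap => /and3P[/(im _ _ _ _ a) hA /(im _ _ _ _ b) hB /(im _ _ _ _ c) hC];
  apply/resid3_eq0.
Qed.

Lemma hom_moved X Y (g : ends X) : inj3 g -> \dim (lker (defect Y g)) = hdim (moved g) Y.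
Proof. by move=> g0; rewrite lker_defect. Qed.

Definition comp3 X (h g : ends X) : ends X :=
  ((h.1.1 \o g.1.1)%VF, (h.1.2 \o g.1.2)%VF, (h.2 \o g.2)%VF).

Lemma moved_comp X (g h : ends X) : inj3 g -> inj3 h ->
  @moved (moved g) h = moved (comp3 h g).
Proof.
move=> /and3P[a b c] /and3P[a' b' c']; rewrite /moved.
by congr Obj; apply: imflag_comp.
Qed.

(** The three pairs of flags are conjugate by maps [a], [b], [c]; pulling all three back along [a]
    gives endomorphisms of the space of [X]. *)
Lemma moved_ex X Y : dimvec X = dimvec Y -> exists2 g : ends X, inj3 g & iso (moved g) Y.
Proof.
move=> [eA eB eC]; have [a a0 aE] := flag_conj eA.
have [b b0 bE] := flag_conj eB; have [c c0 cE] := flag_conj eC.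
have dXY : \dim {:ospace X} = \dim {:ospace Y}.
  by rewrite -(csize_flag_type (flagA X)) eA csize_flag_type.
have afull : limg a = fullv.
  by apply/eqP; rewrite eqEdim subvf limg_dim_eq ?(eqP a0) ?capv0 // dXY leqnn.
have aK : cancel a^-1%VF a by move=> y; apply: limg_lfunVK; rewrite afull memvf.
have comp0 (u : 'Hom(ospace X, ospace Y)) : lker u == 0%VS -> lker (a^-1 \o u)%VF == 0%VS.
  move=> /lker0P u0; apply/lker0P => x y; rewrite !comp_lfunE => e.
  by apply: u0; rewrite -(aK (u x)) e aK.
exists ((a^-1 \o a)%VF, (a^-1 \o b)%VF, (a^-1 \o c)%VF).
  by apply/and3P; split; apply: comp0.
have im (S : {vspace ospace Y}) : (a @: (a^-1 @: S))%VS = S.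
  apply/vspaceP => y; apply/memv_imgP/idP => [[_ /memv_imgP[z zS ->] ->]|yS].
    by rewrite aK.
  by exists (a^-1%VF y); rewrite ?aK // memv_img.
apply: (@iso_image _ _ _ _ (moved _) (ospace Y) a (flagA Y) (flagB Y) (flagC Y)) => //.
- by move=> i; rewrite /= (imflagE _ _ (comp0 _ a0)) limg_comp im aE.
- by move=> i; rewrite /= (imflagE _ _ (comp0 _ b0)) limg_comp im bE.
- by move=> i; rewrite /= (imflagE _ _ (comp0 _ c0)) limg_comp im cE.
Qed.

Definition line X (h : ends X) (t : F) : ends X := id3 X + t *: h.

Lemma line0 X (h : ends X) : line h 0 = id3 X.
Proof. by rewrite /line scale0r addr0. Qed.

Lemma line1 X (g : ends X) : line (g - id3 X) 1 = g.
Proof. by rewrite /line scale1r addrC subrK. Qed.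

Lemma inj3_line X (h : ends X) t :
  inj3 (line h t) = [&& lker (\1%VF + t *: h.1.1) == 0%VS,
    lker (\1%VF + t *: h.1.2) == 0%VS & lker (\1%VF + t *: h.2) == 0%VS].
Proof. by []. Qed.

Lemma defect_line X Y (h : ends X) t :
  defect Y (line h t) = defect Y (id3 X) + t *: defect Y h.
Proof. exact: defect_linear. Qed.

End Defect.

(** * Deformations along lines *)

Section Deformations.
Variables (F : fieldType) (p q r : nat).
Local Notation obj := (obj F p q r).
Implicit Types (X Y Z L K : obj) (d e : triple p q r).

Lemma almost_all_inj (V : vectType F) (g h : 'End(V)) t0 :
  lker (g + t0 *: h)%R == 0%VS -> almost_all (fun t => lker (g + t *: h)%R == 0%VS).
Proof.
rewrite -dimv_eq0 => /eqP k0; apply: almost_allS (lfun_pencil_ker g h t0) => t.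
by rewrite k0 leqn0 dimv_eq0.
Qed.

Lemma almost_all_inj3 X (h : ends X) t0 :
  inj3 (line h t0) -> almost_all (fun t => inj3 (line h t)).
Proof.
rewrite inj3_line; case/and3P => /almost_all_inj aA /almost_all_inj aB /almost_all_inj aC.
apply: almost_allS (almost_allI aA (almost_allI aB aC)) => t [kA [kB kC]].
by rewrite inj3_line kA kB kC.
Qed.

Lemma almost_all_hom X Y (h : ends X) t0 : inj3 (line h t0) ->
  almost_all (fun t => inj3 (line h t) /\
    (hdim (moved (line h t)) Y <= hdim (moved (line h t0)) Y)%N).
Proof.
move=> i0; apply: almost_allS (almost_allI (almost_all_inj3 i0)
  (lfun_pencil_ker (defect Y (id3 X)) (defect Y h) t0)) => t [it].
by rewrite -!defect_line !hom_moved.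
Qed.

Lemma inj3_one X : inj3 (id3 X).
Proof.
have k0 : lker (\1%VF : 'End(ospace X)) == 0%VS by apply/lker0P => x y; rewrite !id_lfunE.
exact/and3P.
Qed.

Lemma hom_moved_one X Y : hdim (moved (id3 X)) Y = hdim X Y.
Proof. by rewrite -hom_moved ?inj3_one // lker_defect_one. Qed.

(** On the line from [X] at 0 to a copy of [Y] at 1, semicontinuity at both ends gives finitely many
    generic conditions. *)
Lemma common_generization X Y m (T : nat -> obj) :
  infinite_field F -> dimvec X = dimvec Y ->
  exists2 Z, dimvec Z = dimvec X & forall k, (k < m)%N ->
    (hdim Z (T k) <= hdim X (T k))%N /\ (hdim Z (T k) <= hdim Y (T k))%N.
Proof.
move=> infF /moved_ex[g gi gY]; pose h := g - id3 X.
have e0 : line h 0 = id3 X by exact: line0.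
have e1 : line h 1 = g := line1 g.
have i0 : inj3 (line h 0) by rewrite e0 inj3_one.
have i1 : inj3 (line h 1) by rewrite e1.
have := almost_all_bounded (n := m) (fun k _ =>
  almost_allI (almost_all_hom (T k) i0) (almost_all_hom (T k) i1)).
move/(almost_allI (almost_all_inj3 i0))/(almost_all_ex infF) => [t [it ht]].
exists (moved (line h t)); first exact: dimvec_moved.
move=> k /ht[[_]]; rewrite e0 hom_moved_one => -> [_].
by rewrite e1 (hom_isol (T k) gY).
Qed.

(** [Z] minimises the sum [mu]. A common generization [Z'] of [Z] and [X] is termwise at most [Z],
    yet its sum is no smaller, so all terms agree; the term at the representative of [Z] is then
    compared with [X]. *)
Lemma minimal_hom e : infinite_field F -> Lambda e -> fin_reps F e ->
  exists2 Z : obj, dimvec Z = e & forall X, dimvec X = e -> (hdim Z Z <= hdim X Z)%N.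
Proof.
move=> infF /(obj_ex F)[Z0 eZ0] [m [T hT]].
pose mu Z := (\sum_(k < m) hdim Z (T k))%N.
have ex_n : exists n, `[< exists2 Z : obj, dimvec Z = e & mu Z = n >].
  by exists (mu Z0); apply/asboolP; exists Z0.
case: (ex_minnP ex_n) => n /asboolP[Z eZ muZ] nmin.
exists Z => // X eX; have [|Z' eZ' hZ'] := @common_generization Z X m T infF; first by rewrite eX.
have [k km Zk] := hT Z eZ; pose k' := Ordinal km.
rewrite (hom_isor Z Zk) (hom_isor X Zk).
have [_ le2] := hZ' k km; apply: leq_trans le2.
have : (mu Z <= mu Z')%N.
  by rewrite muZ; apply: nmin; apply/asboolP; exists Z'; rewrite ?eZ'.
rewrite /mu (bigD1 k') // [X in (_ <= X)%N](bigD1 k') //= => le.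
have le' : (\sum_(i < m | i != k') hdim Z' (T i) <= \sum_(i < m | i != k') hdim Z (T i))%N.
  by apply: leq_sum => i _; have [] := hZ' i (ltn_ord i).
by rewrite -(leq_add2r (\sum_(i < m | i != k') hdim Z' (T i))); apply: leq_trans le;
  rewrite leq_add2l.
Qed.

Lemma rigid_ex e : infinite_field F -> Lambda e -> fin_reps F e ->
  exists2 Z : obj, dimvec Z = e & rigid Z.
Proof.
move=> infF eL efin; have [Z eZ Zmin] := minimal_hom infF eL efin; exists Z => // h.
have e0 : line h 0 = id3 Z by exact: line0.
have i0 : inj3 (line h 0) by rewrite e0 inj3_one.
have one0 : defect Z (id3 Z) \1%VF = 0.
  by apply/eqP; rewrite -memv_ker lker_defect_one homs_id.
(* By minimality of [Z] the kernel dimension at 0 is at most that at generic points, so the tangent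
   criterion applies to the kernel vector 1. *)
have : defect Z h \1%VF \in limg (defect Z (id3 Z)).
  apply: (lfun_pencil_tangent infF _ one0); apply: almost_allS (almost_all_inj3 i0) => t it.
  rewrite -defect_line (hom_moved _ it) lker_defect_one.
  by apply: Zmin; rewrite dimvec_moved.
case/memv_imgP => f _; rewrite !defectE !comp_lfun1r !comp_lfun1l => e1; exists f.
rewrite resid3B; apply/eqP; rewrite subr_eq0; apply/eqP.
by rewrite -e1 -!surjective_pairing.
Qed.

(** Rigidity makes the rank of the defect map maximal at 0. The identity, a kernel vector there,
    therefore deforms to an injective morphism from the moved object to [X]. *)
Lemma rigid_open X (h : ends X) : rigid X ->
  almost_all (fun t => inj3 (line h t) /\ iso (moved (line h t)) X).
Proof.
move=> /rigidE Xr.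
have e0 : line h 0 = id3 X by exact: line0.
have i0 : inj3 (line h 0) by rewrite e0 inj3_one.
have one0 : defect X (id3 X) \1%VF = 0.
  by apply/eqP; rewrite -memv_ker lker_defect_one homs_id.
have k1 : lker (\1%VF : 'End(ospace X)) == 0%VS by apply/lker0P => x y; rewrite !id_lfunE.
have dk t : (\dim (lker (defect X (id3 X))) <=
    \dim (lker (defect X (id3 X) + t *: defect X h)%R))%N.
  rewrite -defect_line.
  have := limg_ker_dim (defect X (id3 X)) fullv.
  have := limg_ker_dim (defect X (line h t)) fullv; rewrite !capfv => ea eb.
  have := dimvS (subv_trans (limg_defect X (line h t)) Xr).
  by rewrite -(leq_add2l (\dim (lker (defect X (line h t))))) ea -eb leq_add2r.
have := lfun_pencil_unit dk one0 k1.
move/(almost_allI (almost_all_inj3 i0)); apply: almost_allS => t [it [f fk f0]].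
split=> //; apply: (@iso_bij _ _ _ _ (moved (line h t)) X f) => //.
  by rewrite -lker_defect // memv_ker defect_line fk.
by rewrite dimvec_moved.
Qed.

Lemma rigid_unique X Y : infinite_field F ->
  rigid X -> rigid Y -> dimvec X = dimvec Y -> iso X Y.
Proof.
move=> infF Xr Yr /moved_ex[g gi gY].
have gr := rigid_iso (iso_sym gY) Yr.
have [a b c] := and3P gi.
pose k : ends X := ((g.1.1)^-1%VF, (g.1.2)^-1%VF, (g.2)^-1%VF).
(* The direction of the same line seen from its point at 1: [(1 + (t - 1)(1 - g^-1)) g = 1 + t (g -
   1)]. *)
pose h' : ends (moved g) := id3 X - k.
have [s1 hs1] := rigid_open (g - id3 X) Xr.
have [s2 hs2] := @rigid_open (moved g) h' gr.
(* A point generic for both ends; the parameter seen from [moved g] is shifted by 1. *)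
have [t [ht1 ht2]] : exists t, t \notin s1 /\ t - 1 \notin s2.
  have [t ht] : exists t, t \notin s1 ++ map (fun s => s + 1) s2.
    by apply: (almost_all_ex infF); exists (s1 ++ map (fun s => s + 1) s2).
  exists t; move: ht; rewrite mem_cat negb_or => /andP[-> ht2]; split=> //.
  by apply: contra ht2 => ht2; apply/mapP; exists (t - 1); rewrite ?subrK.
have [_ X1] := hs1 t ht1; have [i2 X2] := hs2 _ ht2.
rewrite moved_comp // in X2.
have e : @comp3 _ _ _ _ X (@line _ _ _ _ (moved g) h' (t - 1)) g = line (g - id3 X) t.
  have comp (u : 'End(ospace X)) : lker u == 0%VS ->
      ((\1 + (t - 1) *: (\1 - u^-1%VF))%R \o u)%VF = \1%VF + t *: (u - \1%VF).
    move=> u0; rewrite comp_lfunDl comp_lfun1l -comp_lfunZl comp_lfunDl comp_lfun1l.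
    rewrite comp_lfunNl lker0_compVf // [(t - 1) *: _]scalerBl scale1r opprB.
    by rewrite [LHS]addrCA [X in _ + X]addrCA subrr addr0 addrC.
  exact: (congr2 pair (congr2 pair (comp _ a) (comp _ b)) (comp _ c)).
rewrite e in X2.
exact: iso_trans (iso_sym X1) (iso_trans X2 gY).
Qed.

End Deformations.

(** * Bricks *)

Section Bricks.
Variables (F : fieldType) (p q r : nat).
Local Notation obj := (obj F p q r).
Implicit Types (X Y Z L K : obj) (d e : triple p q r).

(** The graded pieces of the induced flag embed in those of [A]. *)
Lemma flag_type_sub (V : vectType F) k (A : flag V k) (U : {vspace V}) (i : 'I_k) :
  (flag_type (Flag (subflag_subproof A U)) i <= flag_type A i)%N.
Proof.
set B := Flag _.
have dB j : \dim (B j) = \dim (A j :&: U).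
  rewrite /B /= ffunE -(@limg_dim_eq _ _ _ (linfun (@vsval _ _ U))).
    congr (\dim _); apply/vspaceP => x; apply/memv_imgP/idP.
      by case=> y; rewrite -memv_preim lfunE => yA ->; rewrite memv_cap yA subvsP.
    rewrite memv_cap => /andP[xA xU]; exists (vsproj U x); last by rewrite lfunE /= vsprojK.
    by rewrite -memv_preim lfunE /= vsprojK.
  apply/eqP; rewrite -subv0; apply/subvP => x; rewrite memv_cap memv_ker lfunE memv0.
  by case/andP=> _ /eqP x0; apply/eqP/subvs_inj; rewrite x0.
rewrite [flag_type B i]ffunE [flag_type A i]ffunE !dB !loE !hiE; have AS := stepS A (ltn_ord i).
have := dimv_sum_cap (step A i) (step A i.+1 :&: U).
have -> : (step A i :&: (step A i.+1 :&: U) = step A i :&: U)%VS.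
  by rewrite capvA; move/capv_idPl: AS => ->.
have : (\dim (step A i + step A i.+1 :&: U) <= \dim (step A i.+1))%N.
  by apply: dimvS; rewrite subv_add AS capvSl.
lia.
Qed.

(** [e] is the dimension vector of the quotient by [U], so its three compositions have the same
    size. This lets finite type pass to subobjects that are not summands. *)
Lemma dimvec_subobj X (U : {vspace ospace X}) :
  exists2 e, Lambda e & dimvec X = e + dimvec (subobj U).
Proof.
pose D k (A : flag (ospace X) k) : composition k :=
  [ffun i => (flag_type A i - flag_type (Flag (subflag_subproof A U)) i)%N].
have DE k (A : flag (ospace X) k) : flag_type A = D k A + flag_type (Flag (subflag_subproof A U)).
  by apply/ffunP => i; rewrite [RHS]ffunE [D k A i]ffunE [RHS]subnK // flag_type_sub.
have DS k (A : flag (ospace X) k) : csize (D k A) = (\dim {:ospace X} - \dim U)%N.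
  have e1 := csize_flag_type A; have e2 := csize_flag_type (Flag (subflag_subproof A U)).
  rewrite dimvf in e2; rewrite -e1 -[X in (_ - X)%N]e2 /csize -sumnB; last first.
    by move=> i _; apply: flag_type_sub.
  by apply: eq_bigr => i _; rewrite ffunE.
exists (D p (flagA X), D q (flagB X), D r (flagC X)); first by split; rewrite /= !DS.
by rewrite /dimvec; congr (_, _, _); apply: DE.
Qed.

Lemma fin_reps_subobj X (U : {vspace ospace X}) :
  fin_reps F (dimvec X) -> fin_reps F (dimvec (subobj U)).
Proof. by have [e eL ->] := dimvec_subobj U; apply: fin_reps_sub. Qed.

Lemma fin_reps_dsum X Y : fin_reps F (dimvec (dsum X Y)) -> fin_reps F (dimvec Y).
Proof. rewrite dimvec_dsum; apply: fin_reps_sub; exact: dimvec_Lambda. Qed.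

Lemma hdim_gt0 X : (0 < \dim {:ospace X})%N -> (0 < hdim X X)%N.
Proof.
move=> X0; rewrite lt0n dimv_eq0; apply/eqP => h0.
have := homs_id X; rewrite h0 memv0 => /eqP/lfunP id0.
suff /eqP f0 : (fullv : {vspace ospace X}) == 0%VS by rewrite f0 dimv0 in X0.
rewrite -subv0; apply/subvP => x _; rewrite memv0; apply/eqP.
by have := id0 x; rewrite id_lfunE zero_lfunE.
Qed.

(** This turns a non-scalar endomorphism into a nonzero non-injective one. *)
Definition eigenvalues_exist := forall (V : vectType F) (f : 'End(V)),
  (0 < \dim {:V})%N -> exists a, lker (f - a *: \1%VF)%R != 0%VS.

(** The projection [s] extends to [X] for each flag separately. The three extensions differ from one
    linear extension [s0] by maps factoring through [phi], and rigidity of [L] reconciles them. *)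
Lemma kernel_retract_rigid X L (phi : 'Hom(ospace X, ospace L)) :
  phi \in homs X L -> rigid L ->
  forall (j : 'Hom(ospace L, ospace (subobj (lker phi))))
    (s : 'Hom(ospace (subobj (lker phi)), ospace L)),
  j \in homs L (subobj (lker phi)) -> s \in homs (subobj (lker phi)) L -> cancel j s ->
  retract L X.
Proof.
move=> phim Lr j s jm sm js; have [iK iKm iKE] := homs_vsval (lker phi).
pose s0 : 'Hom(ospace X, ospace L) := (s \o linfun (vsproj (lker phi)))%VF.
have s0E x : x \in lker phi -> s0 x = s (vsproj (lker phi) x).
  by move=> _; rewrite comp_lfunE lfunE.
have [sA sB sC] := elimT (homsP s) sm.
have [phA phB phC] := elimT (homsP phi) phim.
have [|rA rAK rAm] := @flag_ext _ _ _ _ (flagA X) (flagA L) (lker phi) s0.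
  by move=> i x xK xA; rewrite s0E //; apply: sA; rewrite mem_subobj vsprojK.
have [|rB rBK rBm] := @flag_ext _ _ _ _ (flagB X) (flagB L) (lker phi) s0.
  by move=> i x xK xA; rewrite s0E //; apply: sB; rewrite mem_subobj vsprojK.
have [|rC rCK rCm] := @flag_ext _ _ _ _ (flagC X) (flagC L) (lker phi) s0.
  by move=> i x xK xA; rewrite s0E //; apply: sC; rewrite mem_subobj vsprojK.
have fac (rho : 'Hom(ospace X, ospace L)) : {in lker phi, rho =1 s0} ->
    exists al : 'End(ospace L), rho - s0 = (al \o phi)%VF.
  move=> rs; apply: lfun_factor; apply/subvP => x xK.
  by rewrite memv_ker add_lfunE opp_lfunE rs // subrr.
have [al alE] := fac _ rAK; have [be beE] := fac _ rBK; have [ga gaE] := fac _ rCK.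
have [f /resid3_eq0[/fhomP fA /fhomP fB /fhomP fC]] := Lr ((al, be, ga) : ends L).
(* For each flag, [rho] is the separate extension minus [(al' - f) \o phi], a composite of filtered
   maps. *)
pose rho := s0 + (f \o phi)%VF.
have rhoE (al' : 'End(ospace L)) rA' x : rA' - s0 = (al' \o phi)%VF ->
    rho x = rA' x - (al' - f) (phi x).
  move=> e; have -> : rA' = s0 + (al' \o phi)%VF by rewrite -e addrC subrK.
  by rewrite /rho !add_lfunE !comp_lfunE opp_lfunE opprB addrACA addrA addrK.
have rhom : rho \in homs X L.
  apply/homsP; split=> i x xi.
  - by rewrite (rhoE _ _ _ alE) memvB ?rAm //; apply: fA; apply: phA.
  - by rewrite (rhoE _ _ _ beE) memvB ?rBm //; apply: fB; apply: phB.
  - by rewrite (rhoE _ _ _ gaE) memvB ?rCm //; apply: fC; apply: phC.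
exists (iK \o j)%VF, rho; split=> //; first exact: homs_comp jm iKm.
move=> x; rewrite comp_lfunE iKE /rho add_lfunE comp_lfunE.
have := subvsP (j x); rewrite memv_ker => /eqP->; rewrite linear0 addr0.
by rewrite s0E ?subvsP // vsvalK js.
Qed.

Lemma indecomposable_brick X : infinite_field F -> eigenvalues_exist ->
  fin_reps F (dimvec X) -> indecomposable X -> rigid X /\ hdim X X = 1%N.
Proof.
move=> infF eigF; have [n] := ubnP (\dim {:ospace X}).
elim: n => // n IH in X *; rewrite ltnS => dX Xfin Xind.
have X0 := indecomposable_neq0 Xind.
have scalar f : f \in homs X X -> exists a, f = a *: \1%VF.
  move=> fm; apply: contrapT => fns.
  pose bad (g : 'End(ospace X)) := [/\ g \in homs X X, g != 0 & lker g != 0%VS].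
  have ex_bad : exists m, `[< exists2 g, bad g & \dim (limg g) = m >].
    have [a ka] := eigF _ f X0.
    exists (\dim (limg (f - a *: \1%VF)%R)); apply/asboolP; exists (f - a *: \1%VF) => //.
    split=> //; first by rewrite memvB // memvZ // homs_id.
    by rewrite subr_eq0; apply/eqP => fa; apply: fns; exists a.
  case: (ex_minnP ex_bad) => m /asboolP[g [gm g0 kg] rg] rmin.
  have [|[N gN]] := indecomposable_endo Xind gm; first by rewrite (negPf kg).
  (* Otherwise [g \o g] is bad too; minimality gives it the image of [g], so [g] is onto on its own
     image, against nilpotency. *)
  have gg : (g \o g)%VF = 0.
    apply: contrapT => /eqP gg0.
    have bgg : bad (g \o g)%VF.
      split=> //; first exact: (homs_comp gm gm).
      apply: contra kg => /lker0P gg_inj; apply/lker0P => x y xy.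
      by apply: gg_inj; rewrite !comp_lfunE xy.
    have : (m <= \dim (limg (g \o g)%VF))%N.
      by apply: rmin; apply/asboolP; exists (g \o g)%VF.
    rewrite -rg limg_comp => le.
    have im : (g @: limg g)%VS = limg g.
      by apply/eqP; rewrite eqEdim le limgS ?subvf.
    have it k x : x \in limg g -> exists2 y, y \in limg g & iter k g y = x.
      elim: k x => [|k IHk] x xg; first by exists x.
      rewrite -im in xg; case/memv_imgP: xg => y yg ->.
      by have [z zg <-] := IHk y yg; exists z.
    case/eqP: g0; apply/lfunP => x; rewrite zero_lfunE.
    have [y _ <-] := it N _ (memv_img g (memvf x)); exact: gN.
  have dK : (\dim (lker g) < \dim {:ospace X})%N.
    rewrite ltn_neqAle dimvS ?subvf // andbT; apply/eqP => e.
    have /eqP kf : lker g == fullv by rewrite eqEdim subvf e leqnn.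
    case/eqP: g0; apply/lfunP => x; rewrite zero_lfunE; apply/eqP.
    by rewrite -memv_ker kf memvf.
  pose K := subobj (lker g).
  have [h hE] : exists h : 'Hom(ospace X, ospace K), forall x, h x = vsproj (lker g) (g x).
    by apply: lfun_of_linear => a u v; rewrite !linearP.
  have gK x : g x \in lker g.
    by rewrite memv_ker; have /lfunP/(_ x) := gg; rewrite comp_lfunE zero_lfunE => ->.
  have h0 : h != 0.
    apply: contraNneq g0 => h0; apply/eqP/lfunP => x.
    by rewrite zero_lfunE -(vsprojK (gK x)) -hE h0 zero_lfunE linear0.
  have hm : h \in homs X K.
    have [gA gB gC] := elimT (homsP g) gm.
    by apply/homsP; split=> i x xi; rewrite hE mem_subobj vsprojK //;
      [apply: gA|apply: gB|apply: gC].
  have [L [j [s [Lind jm sm js sh]]]] := indecomposable_summand h0.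
  pose phi := (s \o h)%VF.
  have phim : phi \in homs X L by exact: homs_comp hm sm.
  have [iK iKm iKE] := homs_vsval (lker g).
  (* The endomorphism of [X] through [L]: it is bad and has the kernel of [phi]. Its rank is at
     least [m], which forces [lker phi = lker g]. *)
  pose u := (iK \o j \o phi)%VF.
  have kgphi : (lker g <= lker phi)%VS.
    apply/subvP => x; rewrite !memv_ker /phi comp_lfunE hE => /eqP->.
    by rewrite !linear0.
  have kphiu : lker u = lker phi.
    apply/vspaceP => x; rewrite !memv_ker /u !comp_lfunE; apply/eqP/eqP => [|->].
      rewrite iKE -[X in _ = X](linear0 (@vsval _ _ (lker g))) => /subvs_inj e.
      by rewrite -[LHS]js e linear0.
    by rewrite !linear0.
  have bu : bad u.
    split.
    - exact: homs_comp phim (homs_comp jm iKm).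
    - apply: contraNneq sh => u0; apply/eqP/lfunP => x; rewrite zero_lfunE; apply/eqP.
      by rewrite -memv_ker -kphiu memv_ker u0 zero_lfunE.
    - rewrite kphiu; apply: contra kg => /eqP k0; by rewrite -subv0 -k0.
  have ru : (m <= \dim (limg u))%N by apply: rmin; apply/asboolP; exists u.
  have ekphi : lker g = lker phi.
    apply/eqP; rewrite eqEdim kgphi /= -kphiu.
    have := limg_ker_dim g fullv; have := limg_ker_dim u fullv.
    by rewrite !capfv rg => e2 e1; rewrite -(leq_add2r m) e1 -e2 leq_add2l.
  have retLK : retract L K by exists j, s.
  have [K' KL] := retract_split retLK.
  have dL : (\dim {:ospace L} <= \dim (lker g))%N.
    by have := iso_dim KL; rewrite dim_dsum dim_subobj => ->; rewrite leq_addr.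
  have Lfin : fin_reps F (dimvec L).
    apply: (@fin_reps_dsum K'); rewrite -(iso_dimvec (dsum_comm L K')) -(iso_dimvec KL).
    exact: fin_reps_subobj.
  have [|Lr _] := IH L _ Lfin Lind; first exact: leq_trans (leq_ltn_trans dL dK) dX.
  have retLX : retract L X.
    have := kernel_retract_rigid phim Lr.
    by move: (lker phi) ekphi => _ <- h1; apply: h1 js.
  (* [L] would be isomorphic to [X], but it fits inside the proper subspace [lker g]. *)
  have := retract_indecomposable retLX Xind (indecomposable_neq0 Lind).
  by move/iso_dim => e; move: dK; rewrite -e ltnNge dL.
have hX : hdim X X = 1%N.
  apply/eqP; rewrite eqn_leq hdim_gt0 // andbT.
  have : (homs X X <= <[\1%VF]>)%VS.
    by apply/subvP => f /scalar[a ->]; rewrite memvZ // memv_line.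
  by move/dimvS => le; apply: leq_trans le _; rewrite dim_vline; case: (_ != _).
(* A rigid [Z] of the same dimension vector has Q = dim End Z >= 1, while Q <= dim End X = 1;
   equality makes [X] rigid. *)
split=> //; have [Z eZ /rigid_hom] := rigid_ex infF (dimvec_Lambda X) Xfin.
have dZ : \dim {:ospace Z} = \dim {:ospace X}.
  rewrite -(csize_flag_type (flagA X)) -(csize_flag_type (flagA Z)).
  by case: eZ => ->.
rewrite eZ dZ => e; apply/rigid_hom; apply/eqP; rewrite eqn_leq sqnorms_le hX /= e.
by rewrite leq_add2r leq_mul2l /= hdim_gt0 // dZ.
Qed.

End Bricks.

(** * Algebraically closed fields: infinitude and eigenvalues *)

Lemma closed_field_infinite (F : closedFieldType) : infinite_field F.
Proof.
(* [P] takes the value 1 on [s]; the factor ['X] keeps it nonconstant when [s] is empty. *)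
move=> s; pose P : {poly F} := \prod_(a <- s) ('X - a%:P) * 'X + 1.
have [| t /eqP] := closed_rootP P _.
  rewrite /P size_polyDl size_mulX ?monic_neq0 ?monic_prod_XsubC //
    size_prod_XsubC ?size_poly1 //.
rewrite /P hornerD hornerMX hornerC => Pt; exists t.
apply/negP => ts; move/eqP: Pt.
have /eqP -> : root (\prod_(a <- s) ('X - a%:P)) t by rewrite root_prod_XsubC.
by rewrite mul0r add0r oner_eq0.
Qed.

Lemma closed_field_eigenvalues (F : closedFieldType) : eigenvalues_exist F.
Proof.
move=> V f; rewrite dimvf => V0.
have [|a ra] := closed_rootP (char_poly (f2mx f)) _.
  by rewrite size_char_poly; move: V0; case: (dim V).
exists a; move: ra; rewrite -eigenvalue_root_char => /eigenvalueP[v vf v0].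
apply: contra v0 => /eqP k0; rewrite -(inj_eq (@r2v_inj _ _)) linear0 -memv0 -k0 memv_ker.
rewrite add_lfunE opp_lfunE scale_lfunE id_lfunE subr_eq0; apply/eqP.
by apply: v2r_inj; rewrite v2r_lfun linearZ /= r2vK.
Qed.

(** * Families and orbits *)

Section Families.
Variables (F : fieldType) (p q r : nat).
Hypotheses (infF : infinite_field F) (eigF : eigenvalues_exist F).
Local Notation obj := (obj F p q r).
Implicit Types (X Y Z L K : obj) (d e : triple p q r).

Lemma Tits_eq1 e : Tits e = 1 <-> sqnorms e = (csize e.1.1 ^ 2 + 2)%N.
Proof.
rewrite /Tits /sqnorms; move: (csize e.1.1) (csqnorm e.1.1) (csqnorm e.1.2) (csqnorm e.2) => n a b c.
have two0 : (2%:R : rat) != 0 by rewrite pnatr_eq0.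
rewrite -!natrD -natrX; split=> [h|->].
  have : ((a + b + c)%:R - (n ^ 2)%:R : rat) = 2%:R.
    by rewrite -[LHS](mulfK two0) mulrAC h mul1r.
  move/eqP; rewrite subr_eq -natrD eqr_nat => /eqP->; exact: addnC.
by rewrite natrD addrAC subrr add0r divff.
Qed.

Lemma csize_dimvec X : csize (dimvec X).1.1 = \dim {:ospace X}.
Proof. exact: csize_flag_type. Qed.

Lemma indecomposable_Pi X : fin_reps F (dimvec X) -> indecomposable X -> Pi F (dimvec X).
Proof.
move=> Xfin Xind; have [/rigid_hom e hX] := indecomposable_brick infF eigF Xfin Xind.
split; [exact: dimvec_Lambda|exact/finite_typeP|apply/Tits_eq1].
by rewrite e hX csize_dimvec addnC.
Qed.

(** The projection to [Y], transported to [X], is a scalar [a]: if [a = 0] then [Y] vanishes,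
    otherwise [Z] does. *)
Lemma brick_indecomposable X : hdim X X = 1%N -> indecomposable X.
Proof.
move=> hX; have X0 : ~ iso X (zero_obj F p q r).
  move/iso_zeroP => x0; move: hX; rewrite /hdim.
  suff /eqP -> : homs X X == 0%VS by rewrite dimv0.
  by rewrite -subv0; apply/subvP => f _; rewrite memv0; apply/eqP/lfunP => x; rewrite [LHS]x0 [RHS]x0.
have scalar f : f \in homs X X -> exists a, f = a *: \1%VF.
  move=> fm; apply/vlineP; suff <- : homs X X = <[\1%VF]>%VS by [].
  apply/esym/eqP; rewrite eqEdim -memvE homs_id /= -/(hdim X X) hX dim_vline lt0b.
  apply: contra_not_neq X0 => /lfunP id0; apply/iso_zeroP => x.
  by have := id0 x; rewrite id_lfunE zero_lfunE.
split=> // Y Z /isoP[f [g [fm gm gf fg]]].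
have [iY iYm iYE] := homs_inl Y Z; have [pY pYm pYE] := homs_fst Y Z.
have [|a ea] := scalar ((g \o iY) \o (pY \o f))%VF.
  exact: homs_comp (homs_comp fm pYm) (homs_comp iYm gm).
have eE y z : g (y, 0) = a *: g (y, z).
  have /lfunP/(_ (g (y, z))) := ea.
  by rewrite !comp_lfunE fg pYE iYE scale_lfunE id_lfunE.
have [a0|an0] := eqVneq a 0.
  left; apply/iso_zeroP => y.
  have : (y, 0) = 0 :> ospace (dsum Y Z).
    by apply: (can_inj fg); rewrite (eE y 0) a0 scale0r linear0.
  by case.
right; apply/iso_zeroP => z; have : (0, z) = 0 :> ospace (dsum Y Z).
  apply: (can_inj fg); rewrite linear0; apply/eqP.
  have /eqP := eE 0 z; rewrite [X in X == _](linear0 g) eq_sym scaler_eq0.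
  by rewrite (negPf an0).
by case.
Qed.

(** A rigid object has dim End = Q, which is 1 on [Pi]. *)
Lemma Pi_rigid e : Pi F e -> exists2 Z : obj, dimvec Z = e & rigid Z /\ hdim Z Z = 1%N.
Proof.
case=> eL /finite_typeP efin /Tits_eq1 eT.
have [Z eZ Zr] := rigid_ex infF eL efin; exists Z => //; split=> //.
move/rigid_hom: Zr; rewrite eZ eT -eZ csize_dimvec addnC => /addIn.
by rewrite mulnC -[X in X = _]/(1 * 2)%N => /eqP; rewrite eqn_pmul2r // => /eqP.
Qed.

Lemma indecomposable_unique X Y : Pi F (dimvec X) -> indecomposable X -> indecomposable Y ->
  dimvec X = dimvec Y -> iso X Y.
Proof.
move=> [_ /finite_typeP Xfin _] Xind Yind e.
have [Xr _] := indecomposable_brick infF eigF Xfin Xind.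
rewrite e in Xfin; have [Yr _] := indecomposable_brick infF eigF Xfin Yind.
exact: rigid_unique.
Qed.

Variable I : triple p q r -> obj.
Hypothesis IP : forall e, Pi F e -> indecomposable (I e) /\ dimvec (I e) = e.

Definition sumI (s : seq (triple p q r)) : obj := dsums (map I s).

Lemma sumI_rem e s : e \in s -> iso (sumI s) (dsum (I e) (sumI (rem e s))).
Proof.
elim: s => //= x s IH; rewrite inE eq_sym; have [->|xe] /= := eqVneq x e.
  by move=> _; apply: iso_refl.
move/IH => h; apply: iso_trans (dsum_iso (iso_refl (I x)) h) _.
apply: iso_trans (dsum_assoc _ _ _) _.
apply: iso_trans (dsum_iso (dsum_comm _ _) (iso_refl _)) _.
exact: iso_sym (dsum_assoc _ _ _).
Qed.

Lemma sumI_perm s t : perm_eq s t -> iso (sumI s) (sumI t).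
Proof.
elim: s t => [|x s IH] t pst.
  by move/perm_size: pst => /esym/size0nil->; apply: iso_refl.
have xt : x \in t by rewrite -(perm_mem pst) mem_head.
apply: iso_trans (iso_sym (sumI_rem xt)); apply: dsum_iso (iso_refl _) _; apply: IH.
by rewrite -(perm_cons x) (permPl pst) perm_to_rem.
Qed.

Lemma dimvec_sumI s : (forall e, e \in s -> Pi F e) -> dimvec (sumI s) = \sum_(e <- s) e.
Proof.
elim: s => [|x s IH] sPi; first by rewrite big_nil dimvec_zero.
rewrite /= dimvec_dsum big_cons IH ?(IP _).2 //; first by apply: sPi; rewrite mem_head.
by move=> e es; apply: sPi; rewrite inE es orbT.
Qed.

Lemma retract_sumI L s : (forall e, e \in s -> Pi F e) -> indecomposable L ->
  retract L (sumI s) -> dimvec L \in s.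
Proof.
move=> + Lind; elim: s => [_ [j [t [_ _ jt]]]|x s IH sPi].
  have := indecomposable_neq0 Lind; suff /iso_zeroP/iso_zero-> : forall y : ospace L, y = 0 by [].
  move=> y; rewrite -(jt y); have /iso_zeroP z0 := iso_refl (zero_obj F p q r).
  by rewrite (z0 (j y)) linear0.
have [Ix Ixx] := IP (sPi x (mem_head _ _)).
case/(retract_dsum Lind) => [Lx|Ls].
  have := retract_indecomposable Lx Ix (indecomposable_neq0 Lind).
  by move/iso_dimvec->; rewrite Ixx mem_head.
by rewrite inE IH ?orbT // => e es; apply: sPi; rewrite inE es orbT.
Qed.

(** Uniqueness in Krull-Schmidt: the first summand on the left is a retract of the right side, so
    its index occurs in [t], and it can be cancelled. *)
Lemma sumI_inj s t : (forall e, e \in s -> Pi F e) -> (forall e, e \in t -> Pi F e) ->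
  iso (sumI s) (sumI t) -> perm_eq s t.
Proof.
elim: s t => [|x s IH] t sPi tPi st.
  case: t tPi st => // y t tPi /iso_sym/iso_zero d0.
  have [/indecomposable_neq0 Iy _] := IP (tPi y (mem_head _ _)).
  by move: d0 Iy; rewrite dim_dsum => /eqP; rewrite addn_eq0 => /andP[/eqP-> _].
have [Ix Ixx] := IP (sPi x (mem_head _ _)).
have xt : x \in t.
  rewrite -Ixx; apply: retract_sumI => //; apply: retract_iso st.
  exact: retract_dsuml.
have := perm_to_rem xt; rewrite perm_sym => pt; apply: perm_trans pt; rewrite perm_cons.
apply: IH => [e es|e /mem_rem/tPi //|].
  by apply: sPi; rewrite inE es orbT.
apply: (@dsum_cancel _ _ _ _ (I x)); exact: iso_trans st (sumI_rem xt).
Qed.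

(** * Families as lists of dimension vectors up to permutation *)

Local Notation family := {fsfun triple p q r -> nat with 0%N}.

Definition expand (M : family) : seq (triple p q r) :=
  flatten [seq nseq (M e) e | e <- finsupp M].

Lemma count_expand (M : family) x : count_mem x (expand M) = M x.
Proof.
rewrite /expand count_flatten sumnE !big_map.
rewrite (eq_bigr (fun e => (e == x) * M e)%N) => [|e _]; last by rewrite count_nseq.
have [xM|xM] := boolP (x \in finsupp M); last first.
  rewrite big_seq big1 => [|e eM]; first by move: xM; rewrite memNfinsupp => /eqP.
  by case: eqP eM xM => // -> ->.
rewrite (bigD1_seq x) ?fset_uniq //= eqxx mul1n big1 ?addn0 // => e ex.
by rewrite (negPf ex).
Qed.

Lemma mem_expand (M : family) x : (x \in expand M) = (x \in finsupp M).
Proof.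
by rewrite -has_pred1 has_count count_expand mem_finsupp lt0n.
Qed.

Lemma sum_expand (M : family) : \sum_(e <- expand M) e = \sum_(e <- finsupp M) e *+ M e.
Proof.
rewrite big_flatten big_map; apply: eq_bigr => e _.
by elim: (M e) => [|n IH]; rewrite ?big_nil // big_cons IH mulrS.
Qed.

Lemma mult_dsum_expand (M : family) : iso (mult_dsum I M) (sumI (expand M)).
Proof.
suff expand_seq (s : seq (triple p q r)) :
    iso (\big[@dsum F p q r/zero_obj F p q r]_(e <- s) iter (M e) (dsum (I e)) (zero_obj F p q r))
        (sumI (flatten [seq nseq (M e) e | e <- s])) by exact: expand_seq.
elim: s => [|e s IH]; first by rewrite big_nil; apply: iso_refl.
rewrite big_cons /= /sumI map_cat; apply: iso_trans (iso_sym (dsums_cat _ _)).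
apply: dsum_iso IH; rewrite map_nseq.
by elim: (M e) => [|n IHn]; [apply: iso_refl|apply: dsum_iso (iso_refl _) IHn].
Qed.

Lemma expand_ex (s : seq (triple p q r)) : exists M : family, perm_eq (expand M) s.
Proof.
exists [fsfun x in [fset x in s]%fset => count_mem x s].
apply/allP => x _ /=; rewrite count_expand fsfunE !inE.
by case: ifP => // /negbT; rewrite -has_pred1 has_count lt0n negbK => /eqP->.
Qed.

(** Finite type passes to the indecomposable summands, whose dimension vectors thus lie in [Pi]; by
    uniqueness each summand is the chosen representative. *)
Lemma decomposition_Pi X : fin_reps F (dimvec X) ->
  exists2 s, (forall e, e \in s -> Pi F e) & iso X (sumI s).
Proof.
have [s sind Xs] := decomposition X; rewrite (iso_dimvec Xs) => sfin.
suff [t tPi st] : exists2 t, (forall e, e \in t -> Pi F e) & iso (dsums s) (sumI t).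
  by exists t => //; apply: iso_trans Xs st.
elim: sind sfin {Xs} => [_|L {}s Lind _ IH sfin]; first by exists [::] => //; apply: iso_refl.
have Lfin : fin_reps F (dimvec L).
  by apply: (@fin_reps_dsum _ _ _ _ (dsums s)); rewrite -(iso_dimvec (dsum_comm _ _)).
have LPi := indecomposable_Pi Lfin Lind.
have [t tPi st] := IH (fin_reps_dsum sfin).
exists (dimvec L :: t) => [e|]; first by rewrite inE => /predU1P[->|/tPi].
have [ILind ILe] := IP LPi.
by apply: dsum_iso st; apply: indecomposable_unique.
Qed.

Lemma families_orbits_bij d (V : vectType F) : Lambda d -> finite_type F d ->
  \dim {:V} = csize d.1.1 -> set_bij (families F d) (orbits V d) (Omega I V d).
Proof.
move=> dL /finite_typeP dfin dV.
have famP (M : family) : families F d M ->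
    (forall e, e \in expand M -> Pi F e) /\ dimvec (mult_dsum I M) = d.
  move=> [MPi Md]; have ePi e : e \in expand M -> Pi F e by rewrite mem_expand => /MPi.
  by split=> //; rewrite (iso_dimvec (mult_dsum_expand M)) dimvec_sumI // sum_expand.
have ex M : families F d M -> exists X : Fl3 V d, iso (mult_dsum I M) (obj_of X).
  move=> /famP[_ eM]; apply: Fl3_ex => //.
  by rewrite dV -csize_dimvec eM.
split=> [M /ex[X MX]|M M'|].
(* The direct sum is realised on [V] by [X], and [Omega] is the orbit of [X]. *)
- exists X => //; rewrite orbit3E; apply/seteqP; split=> Y /=.
    by move=> XY; apply: iso_trans (iso_sym XY) (iso_sym MX).
  by move=> YM; apply: iso_sym (iso_trans YM MX).
(* Injectivity: a common point [X] of the two orbits makes the direct sums isomorphic, so the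
   multiplicities agree. *)
- rewrite !inE => hM hM' eO; have [X MX] := ex M hM.
  have : Omega I V d M X by exact: iso_sym MX.
  rewrite eO => XM'.
  have [MPi _] := famP M hM; have [M'Pi _] := famP M' hM'.
  have /permP pe : perm_eq (expand M) (expand M').
    apply: sumI_inj => //; apply: iso_trans (iso_sym (mult_dsum_expand M)) _.
    exact: iso_trans MX (iso_trans XM' (mult_dsum_expand M')).
  by apply/fsfunP => x; rewrite -!count_expand pe.
(* Surjectivity: the multiplicities are read off a decomposition of [X]. *)
- move=> _ [X _ <-].
  have [|s sPi Xs] := @decomposition_Pi (obj_of X); first by rewrite dimvec_obj_of.
  have [M Ms] := expand_ex s.
  have XM : iso (obj_of X) (mult_dsum I M).
    apply: iso_trans Xs _; apply: iso_sym (iso_trans (mult_dsum_expand M) (sumI_perm Ms)).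
  exists M.
    split=> [e eM|]; first by apply: sPi; rewrite -(perm_mem Ms) mem_expand.
    by rewrite -sum_expand (perm_big _ Ms) -dimvec_sumI // -(iso_dimvec Xs) dimvec_obj_of.
  rewrite orbit3E; apply/seteqP; split=> Y /= YM.
    exact: iso_trans XM (iso_sym YM).
  exact: iso_trans (iso_sym YM) XM.
Qed.

End Families.

(** The first half gives existence and uniqueness of the class I_d. The second gives the bijection
    for every choice of representatives [I], which expresses its naturality. *)
Theorem theorem2p3 (F : closedFieldType) (p q r : nat)
    (hp : (0 < p)%N) (hq : (0 < q)%N) (hr : (0 < r)%N)
    (d : triple p q r) (hd : Lambda d) (hfin : finite_type F d)
    (V : vectType F) (hV : \dim (fullv : {vspace V}) = csize d.1.1) :
  (forall e : triple p q r, Pi F e ->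
     exists X : obj F p q r,
       [/\ indecomposable X, dimvec X = e
         & forall Y : obj F p q r, indecomposable Y -> dimvec Y = e -> iso Y X])
  /\
  (forall I : triple p q r -> obj F p q r,
     (forall e : triple p q r, Pi F e -> indecomposable (I e) /\ dimvec (I e) = e) ->
     set_bij (families F d) (orbits V d) (Omega I V d)).
Proof.
have infF := @closed_field_infinite F; have eigF := @closed_field_eigenvalues F.
split=> [e ePi|I IP]; last exact: families_orbits_bij.
have [Z eZ [_ hZ]] := Pi_rigid infF ePi; have Zind := brick_indecomposable hZ.
exists Z; split=> // Y Yind eY.
by apply: indecomposable_unique; rewrite // ?eY ?eZ.
Qed.
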